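(* Consider an F-RAN with $M$ edge nodes, each with fractional cache size $\mu\in[0,1]$, $K$ users, a library of $N\ge K$ files, and fronthaul capacity $C_F=r\log(P)$ bits per symbol, $r\ge 0$. Then the minimum NDT (serial fronthaul-edge transmission) satisfies $\delta^*(\mu,r)\ge \delta_{LB}(\mu,r)$, where $\delta_{LB}(\mu,r)$ is the minimum value of the following linear program in the real variables $\delta_F,\delta_E$: minimize $\delta_F+\delta_E$ subject to $$\ell\,\delta_E+(M-\ell)\,r\,\delta_F\ \ge\ K-(M-\ell)(K-\ell)\mu\quad\text{for all integers }\ell\in\{0,1,\ldots,\min\{M,K\}\},$$ $$\delta_F\ge 0,\qquad \delta_E\ge 1.$$
   Context: F-RAN model (serial transmission). $M$ edge nodes (ENs) serve $K$ users from a library of $N$ files $F_1,\dots,F_N$, independent and uniform on $\{1,\dots,2^L\}$. The channel $\mathbf H=(h_{km})\in\mathbb C^{K\times M}$ has entries drawn i.i.d. from a continuous distribution, is constant during a transmission interval and known to all nodes. The demand vector $\mathbf D=(d_1,\dots,d_K)\in\{1,\dots,N\}^K$ is known to the cloud and ENs. With power $P$ and fronthaul rate $r\ge0$, put $C_F=r\log P$. A policy for file size $L$ consists of: (a) caching functions $S_{m,n}=\pi^m_{c,n}(F_n)$ with entropy $H(S_{m,n})\le\mu L$ (not depending on $\mathbf D,\mathbf H$), with $S_m=(S_{m,1},\dots,S_{m,N})$; (b) fronthaul messages $\mathbf U_m^{T_F}=\pi_f^m(F_1,\dots,F_N,S_m,\mathbf D,\mathbf H)$ of at most $T_FC_F$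 bits; (c) edge codewords $\mathbf X_m^{T_E}=\pi_e^m(S_m,\mathbf U_m^{T_F},\mathbf D,\mathbf H)\in\mathbb C^{T_E}$ with average power at most $P$; (d) decoders $\widehat F_{d_k}=\pi_d^k(\mathbf Y_k^{T_E},d_k,\mathbf H)$, where $\mathbf Y_k^{T_E}=\sum_{m=1}^M h_{km}\mathbf X_m^{T_E}+\mathbf n_k^{T_E}$ and the noise entries are i.i.d. $\mathcal{CN}(0,1)$ over time and users. The error probability is $P_e=\max_{\mathbf D}\max_k\mathbb P(\widehat F_{d_k}\ne F_{d_k})$. A sequence of policies indexed by $L$ is feasible if, for almost all $\mathbf H$, $P_e\to0$ as $L\to\infty$. A delivery time per bit $\Delta(\mu,C_F,P)$ is achievable if some sequence of feasible policies has $\Delta(\mu,C_F,P)=\limsup_{L\to\infty}(T_F+T_E)/L$. The corresponding (achievable) normalized delivery time is $\delta(\mu,r)=\lim_{P\to\infty}\Delta(\mu,r\log P,P)\,\log P$. The minimum NDT $\delta^*(\mu,r)$ is the infimum of all achievable $\delta(\mu,r)$ ($+\infty$ if there is none). Convention: the value of an infeasible minimization linear program is $+\infty$. *)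

(* Defs.v *)
From HB Require Import structures.
From mathcomp Require Import all_boot all_order all_algebra complex.
From mathcomp Require Import all_classical all_reals all_analysis.

Set Implicit Arguments.
Unset Strict Implicit.
Unset Printing Implicit Defensive.

Import Order.TTheory GRing.Theory Num.Theory.
Import numFieldNormedType.Exports.

Local Open Scope classical_set_scope.
Local Open Scope ring_scope.

(* Borel sigma-algebra of R[i], transported from R * R by z |-> (Re z, Im z). *)
Definition reim (R : realType) (z : R[i]) : R * R :=
  (complex.Re z, complex.Im z).

HB.instance Definition _ (R : realType) := isPointed.Build R[i] 0.
HB.instance Definition _ (R : realType) :=
  Measurable.copy R[i] (g_sigma_algebra_preimageType (@reim R)).

Section Probability.
Context (R : realType) (d d' : measure_display) (Omega : measurableType d)
  (T : measurableType d') (Pr : probability Omega R).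

Definition mutually_independent (I : eqType) (X : I -> {RV Pr >-> T}) : Prop :=
  forall (s : seq I) (B : I -> set T), uniq s ->
    (forall i, measurable (B i)) ->
    Pr [set w | forall i, i \in s -> B i (X i w)]
      = (\prod_(i <- s) Pr (X i @^-1` B i))%E.

Definition identically_distributed (I : Type) (X : I -> {RV Pr >-> T}) : Prop :=
  forall (i j : I) (B : set T), measurable B ->
    Pr (X i @^-1` B) = Pr (X j @^-1` B).

Definition iid (I : eqType) (X : I -> {RV Pr >-> T}) : Prop :=
  mutually_independent X /\ identically_distributed X.

(* A continuous distribution is one without atoms; distributions with a
   density are a special case. *)
Definition continuous_law (X : {RV Pr >-> T}) : Prop :=
  forall x : T, Pr (X @^-1` [set x]) = 0%E.

End Probability.

(* CN(0,1): the real and imaginary parts are independent and N(0,1/2);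
   normal_prob takes the standard deviation. *)
Definition std_complex_gaussian (R : realType) (d : measure_display)
    (Omega : measurableType d) (Pr : probability Omega R)
    (X : {RV Pr >-> R[i]}) : Prop :=
  forall A B : set R, measurable A -> measurable B ->
    Pr [set w | A (complex.Re (X w)) /\ B (complex.Im (X w))]
      = (normal_prob 0 (Num.sqrt 2^-1) A * normal_prob 0 (Num.sqrt 2^-1) B)%E.

(* Rates and entropies are in bits. *)
Definition log2 (R : realType) (x : R) : R := ln x / ln 2.

(* Entropy of g U, for U uniform on the finite type T. *)
Definition entropy (R : realType) (T : finType) (A : eqType) (g : T -> A) : R :=
  let prob a := #|[set x | g x == a]|%:R / #|T|%:R in
  - \sum_(a <- undup (codom g)) prob a * log2 (prob a).

Definition file (L : nat) := 'I_(2 ^ L).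
Definition library (N L : nat) := {ffun 'I_N -> file L}.
Definition demand (K N : nat) := {ffun 'I_K -> 'I_N}.
Definition channel (R : realType) (K M : nat) := 'M[R[i]]_(K, M).

(* The (finitely many) possible cache contents and fronthaul messages are
   labelled by natural numbers. *)
Record policy (R : realType) (M K N L : nat) := Policy {
  TF : nat;
  TE : nat;
  pi_c : 'I_M -> 'I_N -> file L -> nat;
  pi_f : 'I_M -> library N L -> ('I_N -> nat) -> demand K N -> channel R K M ->
         nat;
  pi_e : 'I_M -> ('I_N -> nat) -> nat -> demand K N -> channel R K M ->
         TE.-tuple R[i];
  pi_d : 'I_K -> TE.-tuple R[i] -> 'I_N -> channel R K M -> file L
}.

Arguments pi_d {R M K N L} p k y n H.

Section Policy.
Context (R : realType) (M K N L : nat) (p : policy R M K N L).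

Definition cache (f : library N L) (m : 'I_M) : 'I_N -> nat :=
  fun n => pi_c p m n (f n).

Definition fronthaul (f : library N L) (D : demand K N) (H : channel R K M)
    (m : 'I_M) : nat :=
  pi_f p m f (cache f m) D H.

Definition codeword (f : library N L) (D : demand K N) (H : channel R K M)
    (m : 'I_M) : (TE p).-tuple R[i] :=
  pi_e p m (cache f m) (fronthaul f D H m) D H.

Definition received (f : library N L) (D : demand K N) (H : channel R K M)
    (noise : 'I_K * nat -> R[i]) (k : 'I_K) : (TE p).-tuple R[i] :=
  [tuple \sum_m H k m * tnth (codeword f D H m) t + noise (k, val t)
    | t < TE p].

Record admissible (mu CF pow : R) : Prop := Admissible {
  cache_size : forall m n, entropy R (pi_c p m n) <= mu * L%:R;
  (* the message takes values in {0, ..., A - 1} with A <= 2 ^ (TF * CF) *)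
  fronthaul_size : forall f D H m,
    ((fronthaul f D H m).+1)%:R <= 2 `^ ((TF p)%:R * CF);
  (* the average is over channel uses and over the uniform files *)
  average_power : forall D H m,
    (\sum_(f : library N L) \sum_t
        Normc.normc (tnth (codeword f D H m) t) ^+ 2) / #|library N L|%:R
      <= (TE p)%:R * pow;
  decoder_measurable : forall k n H (x : file L),
    measurable [set y : (TE p).-tuple R[i] | pi_d p k y n H = x]
}.

Context (d : measure_display) (Omega : measurableType d)
  (Pr : probability Omega R) (z : 'I_K * nat -> {RV Pr >-> R[i]}).

(* P(decoded file <> F_(D k)) for fixed H: the N files are independent and
   uniform, i.e. uniform on library N L, and independent of the noise. *)
Definition user_error (H : channel R K M) (D : demand K N) (k : 'I_K) : R :=
  (\sum_(f : library N L)
     fine (Pr [set w | pi_d p k (received f D H (fun i => z i w) k) (D k) H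
                       <> f (D k)]))
  / #|library N L|%:R.

Definition error_prob (H : channel R K M) : R :=
  \big[Num.max/0]_(D : demand K N) \big[Num.max/0]_(k < K) user_error H D k.

End Policy.

Section NDT.
Context (R : realType) (M K : nat) (N : nat).
Context (dH : measure_display) (OmegaH : measurableType dH)
  (PrH : probability OmegaH R) (h : 'I_K * 'I_M -> {RV PrH >-> R[i]}).
Context (dZ : measure_display) (OmegaZ : measurableType dZ)
  (PrZ : probability OmegaZ R) (z : 'I_K * nat -> {RV PrZ >-> R[i]}).

Definition channel_at (w : OmegaH) : channel R K M := \matrix_(k, m) h (k, m) w.

Definition feasible (p : forall L, policy R M K N L) : Prop :=
  {ae PrH, forall w, (fun L => error_prob (p L) z (channel_at w)) @ \oo --> 0}.

Definition achievable_delivery_time (mu CF pow : R) (Delta : \bar R) : Prop :=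
  exists p : forall L, policy R M K N L,
    [/\ forall L, admissible (p L) mu CF pow,
        feasible p &
        Delta = limn_esup (fun L => ((TF (p L) + TE (p L))%:R / L%:R)%:E)].

Definition achievable_ndt (mu r : R) (delta : \bar R) : Prop :=
  exists Delta : R -> \bar R,
    (\forall pow \near +oo,
       achievable_delivery_time mu (r * log2 pow) pow (Delta pow)) /\
    (fun pow => Delta pow * (log2 pow)%:E)%E @ +oo --> delta.

Definition min_ndt (mu r : R) : \bar R :=
  ereal_inf [set delta | achievable_ndt mu r delta].

End NDT.

Definition lp_constraints (R : realType) (M K : nat) (mu r dF dE : R) : Prop :=
  [/\ forall l : nat, (l <= minn M K)%N ->
        l%:R * dE + (M%:R - l%:R) * r * dF
          >= K%:R - (M%:R - l%:R) * (K%:R - l%:R) * mu,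
      dF >= 0 & dE >= 1].

Definition delta_LB (R : realType) (M K : nat) (mu r : R) : \bar R :=
  ereal_inf [set (x.1 + x.2)%:E | x in
    [set x : R * R | lp_constraints M K mu r x.1 x.2]].

(* Main.v *)
(* A converse by Gibbs' inequality: if [Q] is positive on the library with total
   mass at most 1, then [N L <= E (- log2 (Q F))].  Fix a set [S] of [l] ENs and
   choose [l] users [U] whose channel rows, restricted to [S], span those of all
   users; such [U] exists for every channel matrix, so no genericity is needed.
   [Q] is the product of the uniform law of the files that are not requested, a
   heavy-tailed law for the noiseless signals of the users in [U] rounded to
   the integer grid ([log2 P] bits per symbol up to a constant), the laws of the
   cache contents and the fronthaul messages of the ENs outside [S], and, for
   each user, the probability that its decoder outputs the right file when fed
   with an estimate of its noiseless signal plus Gaussian noise of twice the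
   amplitude.  The users in [U] are decoded from the rounded signals alone, so
   only the caches of the other [K - l] requested files are paid for; the signals
   of the other users are then recovered up to a bounded error by linear algebra.
   The law of a Gaussian shifted by a bounded vector is dominated, up to a
   constant factor per symbol, by that of the doubled noise, so the decoding
   factors cost [O(TE)] bits plus [L] times the error probability.  Dividing by
   [L] and letting [P] tend to infinity gives the constraints of the program; the
   constraint [dE >= 1] is the same argument with one user and all ENs in [S]. *)

Require Import Defs.
From HB Require Import structures.
From mathcomp Require Import all_boot all_order all_algebra complex.
From mathcomp Require Import all_classical all_reals all_analysis.
From mathcomp Require Import measurable_realfun ring lra.

Import Order.TTheory GRing.Theory Num.Theory.
Import numFieldNormedType.Exports.

Local Open Scope classical_set_scope.
Local Open Scope ring_scope.

Set Implicit Arguments.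
Unset Strict Implicit.
Unset Printing Implicit Defensive.

(** * Domination of shifted Gaussian noise *)

Lemma measurable_fun_affine (R : realType) (a b : R) :
  measurable_fun [set: R] (fun x : R => a * x + b).
Proof.
by apply: measurable_funD => //; apply: measurable_funM.
Qed.

(** Lebesgue measure is determined by its values on half-open intervals, and there the right-hand
    side evaluates to the length. *)
Lemma lebesgue_measure_affine (R : realType) (a b : R) (a_gt0 : 0 < a)
    (A : set R) (mA : measurable A) :
  lebesgue_measure A =
  (a%:E * pushforward lebesgue_measure
    ((fun x => a * x + b)%R : _ -> measurableTypeR R) A)%E.
Proof.
have ha : 0 <= a by exact: ltW.
apply: (lebesgue_measure_unique (mu := mscale (NngNum ha)
  (pushforward lebesgue_measure
    ((fun x => a * x + b)%R : _ -> measurableTypeR R)))) => //=.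
  exact: measurable_fun_affine.
move=> mf _ [[u v]] _ <-.
rewrite /mscale /pushforward /=.
rewrite [X in (_ * lebesgue_measure X)%E](_ : _ =
    [set` `](u - b) / a, (v - b) / a]]); last first.
  apply/seteqP; split => x /=; rewrite !in_itv/= ltr_pdivrMr// ler_pdivlMr//
    ltrBlDr lerBrDr mulrC//.
rewrite !lebesgue_measure_itv/= !lte_fin ltr_pM2r ?invr_gt0// ltrD2r.
case: ifP => _; last by rewrite mule0.
rewrite -!EFinB -EFinM; congr EFin; field; exact: lt0r_neq0.
Qed.

(** Change of variables. Writing the law of an affine image of the noise as an integral over [A]
    lets two such laws be compared through their densities. *)
Lemma normal_prob_affine (R : realType) (s a b : R) (a_gt0 : 0 < a)
    (A : set R) (mA : measurable A) :
  normal_prob 0 s [set x | A (a * x + b)] =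
  (\int[lebesgue_measure]_(x in A)
     (a^-1 * normal_pdf 0 s ((x - b) / a))%:E)%E.
Proof.
have an0 : a != 0 by exact: lt0r_neq0.
have ha : 0 <= a by exact: ltW.
have mf := @measurable_fun_affine R a b.
pose g := fun x : R => (a^-1 * normal_pdf 0 s ((x - b) / a))%:E.
have mg : measurable_fun [set: R] g.
  apply/measurable_EFinP; apply: measurable_funM => //.
  apply: measurableT_comp; first exact: measurable_normal_pdf.
  by apply: measurable_funM => //; apply: measurable_funB.
have g0 x : (0 <= g x)%E.
  by rewrite lee_fin mulr_ge0// ?invr_ge0// normal_pdf_ge0.
rewrite /normal_prob.
rewrite [RHS](eq_measure_integral (mscale (NngNum ha)
  (pushforward lebesgue_measure
    ((fun x => a * x + b)%R : _ -> measurableTypeR R)))); last first.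
  by move=> B mB BA /=; rewrite /mscale /= -lebesgue_measure_affine.
rewrite ge0_integral_mscale//; [|exact: measurable_funTS|by move=> x _; exact: g0].
rewrite ge0_integral_pushforward//; [|exact: measurable_funTS|by move=> x _; exact: g0].
rewrite -ge0_integralZl//; first last.
- by move=> x _; exact: g0.
- exact: measurable_funTS (measurableT_comp mg mf).
- by rewrite -[X in measurable X]setTI; exact: mf.
apply: eq_integral => x _ /=.
rewrite /g -EFinM mulrA mulfV// mul1r addrK.
by rewrite mulrAC mulfV// mul1r.
Qed.

Lemma normal_pdf_half (R : realType) (x : R) :
  normal_pdf 0 (Num.sqrt 2^-1) x =
  normal_peak (Num.sqrt 2^-1) * expR (- x ^+ 2).
Proof.
rewrite normal_pdfE ?sqrtr_eq0 -?ltNge ?invr_gt0//.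
rewrite /normal_fun sqr_sqrtr ?invr_ge0// subr0.
have -> : 2^-1 *+ 2 = 1 :> R by field.
by rewrite divr1.
Qed.

(* The dominating law is a Gaussian of larger variance, hence independent of
   the shift [e]: [y^2 / 4 <= (y - e)^2 + e^2]. *)
Lemma normal_prob_shift_le (R : realType) (C e : R) (eC : `|e| <= C)
    (A : set R) (mA : measurable A) :
  (normal_prob 0 (Num.sqrt 2^-1) [set x | A (x + e)%R] <=
   (2 * expR (C ^+ 2))%:E *
     normal_prob 0 (Num.sqrt 2^-1) [set x | A (2 * x)%R])%E.
Proof.
have -> : [set x : R | A (x + e)] = [set x | A (1 * x + e)].
  by apply/seteqP; split => x /=; rewrite mul1r.
have -> : [set x : R | A (2 * x)] = [set x | A (2 * x + 0)].
  by apply/seteqP; split => x /=; rewrite addr0.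
rewrite !normal_prob_affine//.
have mg (a b c : R) : measurable_fun A
    (fun x : R => (c * normal_pdf 0 (Num.sqrt 2^-1) ((x - b) / a))%:E).
  apply/measurable_EFinP/measurable_funTS; apply: measurable_funM => //.
  apply: measurableT_comp; first exact: measurable_normal_pdf.
  by apply: measurable_funM => //; apply: measurable_funB.
rewrite -ge0_integralZl//; [|exact: mg|].
2: by move=> x _; rewrite lee_fin mulr_ge0// ?invr_ge0// normal_pdf_ge0.
apply: ge0_le_integral => //.
- by move=> x _; rewrite lee_fin mulr_ge0// ?invr_ge0// normal_pdf_ge0.
- exact: mg.
- by apply: measurable_funeM; exact: mg.
move=> x _; rewrite -EFinM lee_fin !normal_pdf_half !invr1 !mulr1 mul1r subr0.
(* The factor 2 in the constant cancels the Jacobian [2^-1] of the doubling; what remains is a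
   comparison of exponents. *)
have -> : 2 * expR (C ^+ 2) *
    (2^-1 * (normal_peak (Num.sqrt 2^-1) * expR (- (x / 2) ^+ 2))) =
  normal_peak (Num.sqrt 2^-1) * expR (C ^+ 2 - (x / 2) ^+ 2) :> R.
  by rewrite expRD; field.
rewrite ler_wpM2l ?normal_peak_ge0// ler_expR.
have : e ^+ 2 <= C ^+ 2.
  by rewrite -real_normK ?num_real// lerXn2r// nnegrE// (le_trans _ eC).
have := sqr_ge0 (x - 2 * e); nra.
Qed.

(** One factor is replaced at a time: [m2] inside the integral over the first variable, then [m1]
    inside the integral over the second. *)
Lemma product_measure_le (R : realType) (d1 d2 : measure_display)
    (T1 : measurableType d1) (T2 : measurableType d2)
    (m1 n1 : probability T1 R) (m2 n2 : probability T2 R) (c1 c2 : R)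
    (c1_ge0 : 0 <= c1) (c2_ge0 : 0 <= c2)
    (mn1 : forall A, measurable A -> (m1 A <= c1%:E * n1 A)%E)
    (mn2 : forall A, measurable A -> (m2 A <= c2%:E * n2 A)%E)
    (A : set (T1 * T2)) (mA : measurable A) :
  ((m1 \x m2) A <= (c1 * c2)%:E * (n1 \x n2) A)%E.
Proof.
(* Both orders of iterated integration give the same measure, since they agree on rectangles. *)
have E (p1 : probability T1 R) (p2 : probability T2 R) :
    (p1 \x p2)%E A = (p1 \x^ p2)%E A.
  apply: product_measure_unique => // B1 B2 mB1 mB2 /=.
  by rewrite product_measure2E.
apply: (@le_trans _ _ (c2%:E * (m1 \x n2) A)%E).
  rewrite /product_measure1 -ge0_integralZl//; last first.
    exact: measurable_fun_xsection.
  apply: ge0_le_integral => //.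
  - exact: measurable_fun_xsection.
  - by apply: measurable_funeM; exact: measurable_fun_xsection.
  - by move=> x _ /=; apply: mn2; exact: measurable_xsection.
rewrite mulrC EFinM -muleA lee_wpmul2l ?lee_fin// !E.
rewrite /product_measure2 -ge0_integralZl//; last first.
  exact: measurable_fun_ysection.
apply: ge0_le_integral => //.
- exact: measurable_fun_ysection.
- by apply: measurable_funeM; exact: measurable_fun_ysection.
- by move=> x _ /=; apply: mn1; exact: measurable_ysection.
Qed.

Lemma indep_product_law (R : realType) (d d1 d2 : measure_display)
    (Omega : measurableType d) (T1 : measurableType d1) (T2 : measurableType d2)
    (Pr : probability Omega R) (X : {mfun Omega >-> T1}) (Y : {mfun Omega >-> T2})
    (XY : forall A B, measurable A -> measurable B ->
      Pr [set w | A (X w) /\ B (Y w)] = (Pr (X @^-1` A) * Pr (Y @^-1` B))%E)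
    (A : set (T1 * T2)) (mA : measurable A) :
  Pr [set w | A (X w, Y w)] = (distribution Pr X \x distribution Pr Y)%E A.
Proof.
have mXY : measurable_fun [set: Omega] (fun w => (X w, Y w)).
  by apply/measurable_fun_pairP; split; exact: measurable_funPT.
pose XY0 : {mfun Omega >-> (T1 * T2)%type} :=
  HB.pack (fun w => (X w, Y w)) (isMeasurableFun.Build _ _ _ _ _ mXY).
by rewrite (product_measure_unique (m' := distribution Pr XY0))// => B1 B2 mB1 mB2.
Qed.

(** * Measurability of complex-valued maps and complex Gaussian shifts *)

Lemma measurable_Re (R : realType) :
  measurable_fun [set: R[i]] (@complex.Re R).
Proof.
move=> _ A mA; rewrite setTI.
change (preimage_set_system setT (@reim R) measurable (@complex.Re R @^-1` A)).
have mB : measurable (A `*` [set: R]) by exact: measurableX.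
exists (A `*` setT) => //.
by apply/seteqP; split=> [z [_ []] | z zA].

Qed.

Lemma measurable_Im (R : realType) :
  measurable_fun [set: R[i]] (@complex.Im R).
Proof.
move=> _ A mA; rewrite setTI.
change (preimage_set_system setT (@reim R) measurable (@complex.Im R @^-1` A)).
have mB : measurable ([set: R] `*` A) by exact: measurableX.
exists (setT `*` A) => //.
by apply/seteqP; split=> [z [_ []] | z zA].

Qed.

Lemma measurable_fun_complex (R : realType) (d : measure_display)
    (T : measurableType d) (f : T -> R[i]) :
  measurable_fun [set: T] (fun x => complex.Re (f x)) ->
  measurable_fun [set: T] (fun x => complex.Im (f x)) ->
  measurable_fun [set: T] f.
Proof.
move=> mre mim _ A [B mB <-]; rewrite setTI.
have mp : measurable_fun [set: T] (fun x => (complex.Re (f x), complex.Im (f x))).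
  by apply/measurable_fun_pairP; split.
by have := mp measurableT _ mB; rewrite !setTI.
Qed.

Lemma measurable_fun_complexD (R : realType) (d : measure_display)
    (T : measurableType d) (f g : T -> R[i]) :
  measurable_fun [set: T] f -> measurable_fun [set: T] g ->
  measurable_fun [set: T] (fun x => f x + g x).
Proof.
move=> mf mg; apply: measurable_fun_complex.
  rewrite (_ : (fun _ => _) = fun x => complex.Re (f x) + complex.Re (g x)).
    by apply: measurable_funD; exact: measurableT_comp (@measurable_Re R) _.
  by apply/funext => x; case: (f x) (g x) => [? ?] [? ?].
rewrite (_ : (fun _ => _) = fun x => complex.Im (f x) + complex.Im (g x)).
  by apply: measurable_funD; exact: measurableT_comp (@measurable_Im R) _.
by apply/funext => x; case: (f x) (g x) => [? ?] [? ?].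
Qed.

Lemma measurable_fun_mktuple (d1 d2 : measure_display)
    (T1 : measurableType d1) (T2 : measurableType d2) (n : nat)
    (f : 'I_n -> T1 -> T2) :
  (forall t, measurable_fun [set: T1] (f t)) ->
  measurable_fun [set: T1] (fun x => [tuple f t x | t < n]).
Proof.
move=> mf; apply/measurable_fun_tnthP => t.
by apply: (eq_measurable_fun (f t)) => // x _ /=; rewrite tnth_mktuple.
Qed.

(** Shifting and doubling act separately on the independent real and imaginary parts, so the
    one-dimensional constant appears squared. *)
Lemma std_complex_gaussian_shift_le (R : realType) (d : measure_display)
    (Omega : measurableType d) (Pr : probability Omega R)
    (X : {RV Pr >-> R[i]}) (X_gaussian : std_complex_gaussian X)
    (C : R) (e : R[i])
    (eC : `|complex.Re e| <= C) (eC' : `|complex.Im e| <= C)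
    (A : set R[i]) (mA : measurable A) :
  (Pr [set w | A (X w + e)%R] <=
   ((2 * expR (C ^+ 2)) ^+ 2)%:E * Pr [set w | A (X w *+ 2)%R])%E.
Proof.
have mRe : measurable_fun [set: Omega] (fun w => complex.Re (X w)).
  exact: measurableT_comp (@measurable_Re R) (measurable_funPT X).
have mIm : measurable_fun [set: Omega] (fun w => complex.Im (X w)).
  exact: measurableT_comp (@measurable_Im R) (measurable_funPT X).
(* The Gaussian hypothesis speaks of rectangles only; [lawE] extends it to all Borel sets of the
   plane by identifying the joint law as a product. *)
have lawE (f g : R -> R) : measurable_fun [set: R] f ->
    measurable_fun [set: R] g -> forall B, measurable B ->
    exists p q : probability R R,
    [/\ forall B, measurable B -> p B = normal_prob 0 (Num.sqrt 2^-1) (f @^-1` B),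
     forall B, measurable B -> q B = normal_prob 0 (Num.sqrt 2^-1) (g @^-1` B) &
     Pr [set w | B (f (complex.Re (X w)), g (complex.Im (X w)))] =
     (p \x q)%E B].
  move=> mf mg B mB.
  have mfX := measurableT_comp mf mRe.
  have mgX := measurableT_comp mg mIm.
  pose U : {mfun Omega >-> R} := HB.pack (f \o (fun w => complex.Re (X w)))
    (isMeasurableFun.Build _ _ _ _ _ mfX).
  pose V : {mfun Omega >-> R} := HB.pack (g \o (fun w => complex.Im (X w)))
    (isMeasurableFun.Build _ _ _ _ _ mgX).
  have mpre (h : R -> R) D : measurable_fun [set: R] h -> measurable D ->
      measurable (h @^-1` D).
    by move=> mh mD; rewrite -[X in measurable X]setTI; exact: mh.
  have UE D : measurable D -> Pr (U @^-1` D) =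
      normal_prob 0 (Num.sqrt 2^-1) (f @^-1` D).
    move=> mD; have := X_gaussian _ _ (mpre _ _ mf mD) measurableT.
    rewrite probability_setT mule1 => <-; congr (Pr _).
    by apply/seteqP; split => w //= [].
  have VE D : measurable D -> Pr (V @^-1` D) =
      normal_prob 0 (Num.sqrt 2^-1) (g @^-1` D).
    move=> mD; have := X_gaussian _ _ measurableT (mpre _ _ mg mD).
    rewrite probability_setT mul1e => <-; congr (Pr _).
    by apply/seteqP; split => w //= [].
  exists (distribution Pr U), (distribution Pr V); split => //.
  rewrite -(@indep_product_law _ _ _ _ _ _ _ Pr U V)// => D E mD mE.
  by rewrite UE// VE// -X_gaussian//; exact: mpre.
pose B := [set u : R * R | A (Complex u.1 u.2)].
have mB : measurable B.
  have mc : measurable_fun [set: R * R] (fun u : R * R => Complex u.1 u.2).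
    by apply: measurable_fun_complex; [exact: measurable_fst|exact: measurable_snd].
  by have := mc measurableT _ mA; rewrite setTI.
have m1 : measurable_fun [set: R] (fun x : R => x + complex.Re e).
  exact: measurable_funD.
have m2 : measurable_fun [set: R] (fun x : R => x + complex.Im e).
  exact: measurable_funD.
have m3 : measurable_fun [set: R] (fun x : R => 2 * x).
  exact: measurable_funM.
have [p [q [pE qE]]] := lawE _ _ m1 m2 _ mB.
have -> : [set w | B (complex.Re (X w) + complex.Re e, complex.Im (X w) + complex.Im e)]
   = [set w | A (X w + e)].
  by apply/seteqP; split => w /=; rewrite /B /=; case: (X w) => ? ?; case: (e).
move=> ->.
have [p' [q' [pE' qE']]] := lawE _ _ m3 m3 _ mB.
have -> : [set w | B (2 * complex.Re (X w), 2 * complex.Im (X w))]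
   = [set w | A (X w *+ 2)].
  have dbl (u : R[i]) : u *+ 2 = Complex (2 * complex.Re u) (2 * complex.Im u).
    by case: u => x y /=; rewrite !mulr_natl.
  by apply/seteqP; split => w /=; rewrite /B dbl.
move=> ->.
have C0 : 0 <= C by exact: le_trans eC.
rewrite expr2; apply: product_measure_le => //.
- by move=> D mD; rewrite pE// pE'//; exact: normal_prob_shift_le.
- by move=> D mD; rewrite qE// qE'//; exact: normal_prob_shift_le.
Qed.

(** * Laws of tuples of independent variables *)

Lemma mutually_independent_reindex (R : realType) (d d' : measure_display)
    (Omega : measurableType d) (T : measurableType d')
    (Pr : probability Omega R) (I J : eqType) (f : I -> J)
    (X : J -> {RV Pr >-> T}) :
  injective f -> mutually_independent X ->
  mutually_independent (fun i => X (f i)).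
Proof.
move=> fI indep s B s_uniq mB.
(* [C] transports [B] along [f]: by injectivity at most one index of [s] lies over [j], and an index
   with no preimage in [s] gets no constraint. *)
pose C j := if [seq i <- s | f i == j] is i :: _ then B i else setT.
have CE i : i \in s -> C (f i) = B i.
  move=> si; rewrite /C.
  have : i \in [seq i0 <- s | f i0 == f i] by rewrite mem_filter eqxx.
  case Es : [seq i0 <- s | f i0 == f i] => [//|i' r] _.
  have : i' \in [seq i0 <- s | f i0 == f i] by rewrite Es mem_head.
  by rewrite mem_filter => /andP[/eqP/fI -> _].
have := indep (map f s) C; rewrite map_inj_uniq// => /(_ s_uniq).
have mC j : measurable (C j) by rewrite /C; case: [seq i <- s | f i == j].
move=> /(_ mC); rewrite big_map.
rewrite [X in _ = X -> _](eq_big_seq (fun i => Pr (X (f i) @^-1` B i)));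
  last by move=> i si /=; rewrite CE.
move=> <-; congr (Pr _); apply/seteqP; split => w /= H.
- by move=> _ /mapP[i si ->]; rewrite CE//; exact: H.
- by move=> i si; have := H (f i) (map_f _ si); rewrite CE.
Qed.

Lemma mutually_independent_comp (R : realType) (d d' : measure_display)
    (Omega : measurableType d) (T : measurableType d')
    (Pr : probability Omega R) (I : eqType) (X Y : I -> {RV Pr >-> T})
    (a : I -> T -> T) (ma : forall i, measurable_fun [set: T] (a i)) :
  (forall i w, Y i w = a i (X i w)) ->
  mutually_independent X -> mutually_independent Y.
Proof.
move=> YE indep s B s_uniq mB.
have mB' i : measurable (a i @^-1` B i).
  by rewrite -[X in measurable X]setTI; exact: ma.
have := indep s (fun i => a i @^-1` B i) s_uniq mB'.
have E i : X i @^-1` (a i @^-1` B i) = Y i @^-1` B i.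
  by apply/seteqP; split => w /=; rewrite YE.
under eq_bigr do rewrite E.
by move=> <-; congr (Pr _); apply/seteqP; split => w /= H i si;
  move: (H i si); rewrite YE.
Qed.

(** Boxes are stable under intersection, so with this generation property two finite measures on
    tuples can be compared on boxes alone. *)
Lemma measurable_tuple_rectangles (d : measure_display) (T : measurableType d)
    (n : nat) :
  measurable = <<s [set A : set (n.-tuple T) | exists B : 'I_n -> set T,
    (forall t, measurable (B t)) /\ A = [set y | forall t, B t (tnth y t)]] >>.
Proof.
apply/seteqP; split.
- apply: smallest_sub; first exact: smallest_sigma_algebra.
  move=> A; rewrite -bigcup_seq/= => -[t _ [B mB <-]]; rewrite setTI.
  apply: sub_sigma_algebra; exists (fun s => if s == t then B else setT).
  split=> [s|]; first by case: ifP.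
  apply/seteqP; split => y /=; last by move=> /(_ t); rewrite eqxx.
  by move=> By s; case: eqP => // ->.
- apply: smallest_sub; first exact: sigma_algebra_measurable.
  move=> A [B [mB ->]].
  rewrite (_ : [set y | _] = \big[setI/setT]_(t < n) ((fun y => tnth y t) @^-1` B t)).
    apply: bigsetI_measurable => t _.
    by rewrite -[X in measurable X]setTI; exact: measurable_tnth.
  rewrite -bigcap_seq; apply/seteqP; split => y /= H t; first by move=> _; exact: H.
  exact: (H t (mem_index_enum t)).
Qed.

(** For fixed [A] both sides are finite measures in [B], and on boxes they agree by mutual
    independence. *)
Lemma mutually_independent_head_tail (R : realType) (d d' : measure_display)
    (Omega : measurableType d) (T : measurableType d')
    (Pr : probability Omega R) (X : nat -> {RV Pr >-> T}) (n : nat)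
    (V : {mfun Omega >-> n.-tuple T}) :
  mutually_independent X ->
  (forall w, V w = [tuple X t.+1 w | t < n]) ->
  forall A B, measurable A -> measurable B ->
  Pr [set w | A (X 0%N w) /\ B (V w)] = (Pr (X 0%N @^-1` A) * Pr (V @^-1` B))%E.
Proof.
move=> indep VE A B mA mB.
have mXA : measurable (X 0%N @^-1` A).
  by rewrite -[X in measurable X]setTI; exact: (measurable_funPT (X 0%N)).
have mV : measurable_fun [set: Omega] V by exact: measurable_funPT.
have PA_ge0 : 0 <= fine (Pr (X 0%N @^-1` A)) by rewrite fine_ge0.
pose m1_of : {measure set (n.-tuple T) -> \bar R} :=
  HB.pack (pushforward (mrestr Pr mXA) V) (Measure.on (pushforward (mrestr Pr mXA) V)).
pose m1 := m1_of mV.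
pose m2 := mscale (NngNum PA_ge0) (distribution Pr V).
have m2E D : m2 D = (Pr (X 0%N @^-1` A) * Pr (V @^-1` D))%E.
  by rewrite /m2 /mscale /= fineK ?fin_num_measure.
have m1E D : m1 D = Pr (V @^-1` D `&` X 0%N @^-1` A) by [].
suff H : m1 B = m2 B.
  move: H; rewrite m1E m2E => <-; congr (Pr _).
  by apply/seteqP; split => w [].
apply: (measure_unique _ (fun _ => setT) (@measurable_tuple_rectangles _ T n)
  _ _ _ m1 m2) => //.
- move=> _ _ [B1 [mB1 ->]] [B2 [mB2 ->]].
  exists (fun t => B1 t `&` B2 t); split; first by move=> t; exact: measurableI.
  apply/seteqP; split => y /=; first by move=> [H1 H2] t; split.
  by move=> H; split => t; have [] := H t.
- move=> _; exists (fun _ => setT); split => //.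
  by apply/seteqP; split.
- by rewrite bigcup_const//; exists 0%N.
- move=> _ [C [mC ->]].
  rewrite [RHS]m2E m1E.
  (* Index 0 carries [A] and index [t + 1] carries [C t]. Independence is used twice, on the indices
     [1..n] and on [0..n]. *)
  pose C' t : set T := if t is t'.+1 then
    (if insub t' is Some u then C u else setT) else A.
  have mC' t : measurable (C' t).
    by case: t => //= t; case: insubP.
  have C'E (u : 'I_n) : C' u.+1 = C u by rewrite /C'/= valK.
  have EV : V @^-1` [set y | forall t, C t (tnth y t)] =
      [set w | forall i, i \in [seq t.+1 | t <- iota 0 n] -> C' i (X i w)].
    apply/seteqP; split => w /=; rewrite VE => H.
    + move=> i /mapP[t]; rewrite mem_iota /= add0n => tn ->.
      by have := H (Ordinal tn); rewrite tnth_mktuple -C'E.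
    + move=> t; rewrite tnth_mktuple -C'E; apply: H.
      by apply: map_f; rewrite mem_iota /= add0n.
  have uq : uniq [seq t.+1 | t <- iota 0 n].
    by rewrite map_inj_uniq ?iota_uniq// => ? ? [].
  rewrite EV (indep _ _ uq mC').
  have uq0 : uniq (0%N :: [seq t.+1 | t <- iota 0 n]).
    by rewrite /= uq andbT; apply/mapP => -[].
  have := indep _ _ uq0 mC'; rewrite big_cons /= => <-; congr (Pr _).
  apply/seteqP; split => w /=.
  + move=> [H Aw] i; rewrite inE => /orP[/eqP -> //|si]; exact: H.
  + move=> H; split; last exact: (H 0%N).
    by move=> i si; apply: H; rewrite inE si orbT.
- by move=> _; rewrite m1E preimage_setT setTI (le_lt_trans (probability_le1 _ mXA))// ltry.
Qed.

(** Induction on [n]: the law of the tuple is the product of the laws of its head and its tail, and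
    the constants multiply. *)
Lemma mutually_independent_tuple_le (R : realType) (d d' : measure_display)
    (Omega : measurableType d) (T : measurableType d')
    (Pr : probability Omega R) (c : R) (c_ge0 : 0 <= c) (n : nat)
    (X Y : nat -> {RV Pr >-> T}) :
  mutually_independent X -> mutually_independent Y ->
  (forall t B, measurable B -> (Pr (X t @^-1` B) <= c%:E * Pr (Y t @^-1` B))%E) ->
  forall A : set (n.-tuple T), measurable A ->
  (Pr [set w | A [tuple X t w | t < n]] <=
   (c ^+ n)%:E * Pr [set w | A [tuple Y t w | t < n]])%E.
Proof.
elim: n X Y => [|n IH] X Y indX indY XY A mA.
  rewrite expr0 mul1e [X in (_ <= Pr X)%E](_ : _ = [set w | A [tuple X t w | t < 0]])//.
  by apply/seteqP; split => w /=; rewrite [X in A X](tuple0 _) [X in _ -> A X](tuple0 _).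
have mtail (Z : nat -> {RV Pr >-> T}) :
    measurable_fun [set: Omega] (fun w => [tuple Z t.+1 w | t < n]).
  by apply: measurable_fun_mktuple => t; exact: measurable_funPT.
pose V (Z : nat -> {RV Pr >-> T}) : {mfun Omega >-> n.-tuple T} :=
  HB.pack (fun w => [tuple Z t.+1 w | t < n])
    (isMeasurableFun.Build _ _ _ _ _ (mtail Z)).
have mcons : measurable_fun [set: T * n.-tuple T]
    (fun u : T * n.-tuple T => [the n.+1.-tuple T of u.1 :: u.2]).
  by apply: measurable_cons; [exact: measurable_fst|exact: measurable_snd].
pose A' := [set u : T * n.-tuple T | A [the n.+1.-tuple T of u.1 :: u.2]].
have mA' : measurable A' by have := mcons measurableT _ mA; rewrite setTI.
have E (Z : nat -> {RV Pr >-> T}) : mutually_independent Z ->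
    Pr [set w | A [tuple Z t w | t < n.+1]] =
    (distribution Pr (Z 0%N) \x distribution Pr (V Z))%E A'.
  move=> indZ; rewrite -(@indep_product_law _ _ _ _ _ _ _ Pr (Z 0%N) (V Z)) //.
    have tE w : [tuple Z t w | t < n.+1] =
        [the n.+1.-tuple T of Z 0%N w :: [tuple Z t.+1 w | t < n]].
      apply: eq_from_tnth => t; case: (unliftP ord0 t) => [u ->|->].
        by rewrite tnthS !tnth_mktuple.
      by rewrite tnth0 tnth_mktuple.
    by congr (Pr _); apply/seteqP; split => w; rewrite /A' /= tE.
  exact: mutually_independent_head_tail.
rewrite E// E// exprS; apply: product_measure_le => //.
- by rewrite exprn_ge0.
- by move=> B mB; exact: XY.
- move=> B mB.
  change (Pr [set w | B [tuple X t.+1 w | t < n]] <=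
    (c ^+ n)%:E * Pr [set w | B [tuple Y t.+1 w | t < n]])%E.
  apply: (IH (fun t => X t.+1) (fun t => Y t.+1)) => //.
  + by apply: (@mutually_independent_reindex _ _ _ _ _ _ _ _ S) indX => ? ? [].
  + by apply: (@mutually_independent_reindex _ _ _ _ _ _ _ _ S) indY => ? ? [].
  + by move=> t D mD; exact: XY.
Qed.

Lemma gaussian_tuple_shift_le (R : realType) (d : measure_display)
    (Omega : measurableType d) (Pr : probability Omega R) (n : nat)
    (X : nat -> {RV Pr >-> R[i]}) (X_indep : mutually_independent X)
    (X_gaussian : forall t, std_complex_gaussian (X t))
    (C : R) (C_ge0 : 0 <= C) (u v : 'I_n -> R[i])
    (uvRe : forall t, `|complex.Re (u t - v t)| <= C)
    (uvIm : forall t, `|complex.Im (u t - v t)| <= C)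
    (A : set (n.-tuple R[i])) (mA : measurable A) :
  (Pr [set w | A [tuple (u t + X t w)%R | t < n]] <=
   (((2 * expR (C ^+ 2)) ^+ 2) ^+ n)%:E *
     Pr [set w | A [tuple (v t + X t w *+ 2)%R | t < n]])%E.
Proof.
(* The noise is indexed by [nat], so the two signals are extended by 0 beyond [n]; there the shift
   [u - v] is 0 and still bounded by [C]. *)
pose ext (x : 'I_n -> R[i]) t := if insub t is Some s then x s else 0.
have extE x (t : 'I_n) : ext x t = x t by rewrite /ext valK.
have ma (x : R[i]) : measurable_fun [set: R[i]] (fun y => y + x).
  exact: measurable_fun_complexD.
have mb (x : R[i]) : measurable_fun [set: R[i]] (fun y => y *+ 2 + x).
  by apply: measurable_fun_complexD => //; exact: measurable_fun_complexD.
pose Y t : {RV Pr >-> R[i]} := HB.pack ((fun y => y + ext u t) \o X t)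
  (isMeasurableFun.Build _ _ _ _ _
     (measurableT_comp (ma (ext u t)) (measurable_funPT (X t)))).
pose Z t : {RV Pr >-> R[i]} := HB.pack ((fun y => y *+ 2 + ext v t) \o X t)
  (isMeasurableFun.Build _ _ _ _ _
     (measurableT_comp (mb (ext v t)) (measurable_funPT (X t)))).
have := @mutually_independent_tuple_le _ _ _ _ _ Pr ((2 * expR (C ^+ 2)) ^+ 2)
  (sqr_ge0 _) n Y Z _ _ _ A mA.
have -> : [set w | A [tuple (u t + X t w)%R | t < n]] = [set w | A [tuple Y t w | t < n]].
  congr (fun f => [set w | A (f w)]); apply/funext => w; apply: eq_from_tnth => t.
  by rewrite !tnth_mktuple /Y /= extE addrC.
have -> : [set w | A [tuple (v t + X t w *+ 2)%R | t < n]] = [set w | A [tuple Z t w | t < n]].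
  congr (fun f => [set w | A (f w)]); apply/funext => w; apply: eq_from_tnth => t.
  by rewrite !tnth_mktuple /Z /= extE addrC.
apply.
- by apply: (mutually_independent_comp (X := X) (a := fun t y => y + ext u t)).
- by apply: (mutually_independent_comp (X := X) (a := fun t y => y *+ 2 + ext v t)).
move=> t B mB.
(* Translating the target by [v] leaves doubled noise on one side and a shift by [u - v] on the
   other. *)
have mB' : measurable [set y | B (y + ext v t)].
  by have := ma (ext v t) measurableT _ mB; rewrite setTI.
have := @std_complex_gaussian_shift_le _ _ _ Pr (X t) (X_gaussian t) C
  (ext u t - ext v t) _ _ _ mB'.
rewrite [X in (Pr X <= _)%E](_ : _ = Y t @^-1` B); last first.
  by apply/seteqP; split => w /=; rewrite -addrA subrK.
apply.
- by rewrite /ext; case: insubP => [s _ _|_]; rewrite ?subrr ?normr0.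
- by rewrite /ext; case: insubP => [s _ _|_]; rewrite ?subrr ?normr0.
Qed.

(** * Subdistributions and Gibbs' inequality *)

Section Log2.
Context {R : realType}.
Implicit Types x y : R.

Lemma ln2_gt0 : 0 < ln 2 :> R.
Proof. by rewrite ln_gt0// ltr1n. Qed.

Lemma log2M x y : 0 < x -> 0 < y -> log2 (x * y) = log2 x + log2 y.
Proof. by move=> x0 y0; rewrite /log2 lnM ?posrE// mulrDl. Qed.

Lemma log2V x : 0 < x -> log2 x^-1 = - log2 x.
Proof. by move=> x0; rewrite /log2 lnV ?posrE// mulNr. Qed.

Lemma log2X x n : 0 < x -> log2 (x ^+ n) = n%:R * log2 x.
Proof. by move=> x0; rewrite /log2 lnXn// -[ln x *+ n]mulr_natl mulrA. Qed.

Lemma log2_2 : log2 2 = 1 :> R.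
Proof. by rewrite /log2 divff// gt_eqF// ln2_gt0. Qed.

Lemma log2_powR2 x : log2 (2 `^ x) = x.
Proof. by rewrite /log2 ln_powR mulfK// gt_eqF// ln2_gt0. Qed.

Lemma ler_log2 x y : 0 < x -> x <= y -> log2 x <= log2 y.
Proof.
move=> x0 xy; rewrite /log2 ler_wpM2r ?invr_ge0 ?(ltW ln2_gt0)//.
by rewrite ler_ln// posrE// (lt_le_trans x0).
Qed.

Lemma log2_prod (I : Type) (s : seq I) (P : pred I) (F : I -> R) :
  (forall i, P i -> 0 < F i) ->
  log2 (\prod_(i <- s | P i) F i) = \sum_(i <- s | P i) log2 (F i).
Proof.
move=> F0; suff: 0 < \prod_(i <- s | P i) F i /\
    log2 (\prod_(i <- s | P i) F i) = \sum_(i <- s | P i) log2 (F i) by case.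
apply: (big_ind2 (fun a b => 0 < a /\ log2 a = b)).
- by rewrite /log2 ln1 mul0r.
- by move=> a b c e [a0 <-] [c0 <-]; rewrite mulr_gt0// log2M.
- by move=> i /F0.
Qed.

End Log2.

Section Subdistributions.
Context {R : realType}.

(** Finite duplicate-free lists replace infinite sums, so that finite types and [nat] are treated
    alike. *)
Definition subdist (X : eqType) (w : X -> R) : Prop :=
  (forall x, 0 <= w x) /\ forall s, uniq s -> \sum_(x <- s) w x <= 1.

Lemma subdist_fin (X : finType) (w : X -> R) :
  (forall x, 0 <= w x) -> \sum_x w x <= 1 -> subdist w.
Proof.
move=> w0 w1; split=> // s us; rewrite big_uniq//=.
by apply: le_trans w1; rewrite [leRHS](bigID (mem s))/= lerDl sumr_ge0.
Qed.

Lemma subdist_nat (w : nat -> R) :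
  (forall x, 0 <= w x) -> (forall m, \sum_(j < m) w j <= 1) -> subdist w.
Proof.
move=> w0 w1; split=> // s us.
pose m := (\max_(x <- s) x).+1.
apply: (le_trans _ (w1 m)).
rewrite -(big_mkord xpredT) (perm_big [seq x <- index_iota 0 m | x \in s]).
  rewrite big_filter [leRHS](bigID (mem s))/= lerDl.
  by apply: sumr_ge0 => ? _.
apply: uniq_perm => //; first by rewrite filter_uniq// iota_uniq.
move=> x; rewrite mem_filter mem_index_iota /= ltnS.
by case: (boolP (x \in s)) => //= xs; rewrite leq_bigmax_seq.
Qed.

(** Serves for fronthaul messages, where [B] is [2 ^ (TF * CF)] and need not be an integer. *)
Lemma subdist_uniform (B : R) : 0 < B ->
  subdist (fun x : nat => if x.+1%:R <= B then B^-1 else 0).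
Proof.
move=> B0; apply: subdist_nat.
  by move=> x; case: ifP => // _; rewrite invr_ge0 ltW.
(* The induction carries the exact value of the sum as long as [m <= B]; beyond that no term is
   added. *)
move=> m; suff: \sum_(j < m) (if j.+1%:R <= B then B^-1 else 0) <= 1 /\
  (m%:R <= B -> \sum_(j < m) (if j.+1%:R <= B then B^-1 else 0) = m%:R / B) by case.
elim: m => [|m [IH1 IH2]]; first by rewrite big_ord0 mul0r; split.
rewrite big_ord_recr /=; case: ifP => mB; last by rewrite addr0.
have mB' : m%:R <= B by rewrite (le_trans _ mB)// ler_nat.
rewrite IH2// -[X in _ + X]mul1r -mulrDl natr1.
by split=> //; rewrite ler_pdivrMr// mul1r.
Qed.

(* Telescoping: [w j = s / (s + j) - s / (s + j + 1)]. *)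
Definition heavy_tail (s : R) (j : nat) : R := s / ((s + j%:R) * (s + j.+1%:R)).

Lemma heavy_tail_gt0 s j : 0 < s -> 0 < heavy_tail s j.
Proof. by move=> s0; rewrite divr_gt0// mulr_gt0// ltr_wpDr. Qed.

Lemma subdist_heavy_tail s : 0 < s -> subdist (heavy_tail s).
Proof.
move=> s0; apply: subdist_nat => [j|m]; first exact/ltW/heavy_tail_gt0.
have sn n : s + n%:R != 0 by rewrite gt_eqF// ltr_wpDr.
suff -> : \sum_(j < m) heavy_tail s j = 1 - s / (s + m%:R).
  by rewrite gerBl divr_ge0 ?ltW// ltr_wpDr.
elim: m => [|m IH]; first by rewrite big_ord0 addr0 divff ?gt_eqF// subrr.
rewrite big_ord_recr /= IH /heavy_tail.
have := sn m; have := sn m.+1; rewrite -natr1 => h1 h2; field.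
by rewrite h1 h2.
Qed.

(** With [s] the square root of the power, the excess over [log2 s] is quadratic in [j / s], so the
    power constraint bounds its mean. *)
Lemma log2_heavy_tail s j : 1 <= s ->
  - log2 (heavy_tail s j) <=
  log2 s + (3 + 2 * j%:R ^+ 2 / s ^+ 2) / ln 2.
Proof.
move=> s1; have s0 : 0 < s by exact: lt_le_trans s1.
(* The weight is at least [s^-1 / (1 + x) ^+ 2]; then [ln (1 + x) <= x], and [2 x] is bounded by
   completing a square. *)
pose x : R := j.+1%:R / s.
have x0 : 0 < x by rewrite divr_gt0.
have : s^-1 / (1 + x) ^+ 2 <= heavy_tail s j.
  rewrite /heavy_tail.
  have -> : s^-1 / (1 + x) ^+ 2 = s / (s + j.+1%:R) ^+ 2.
    by rewrite /x; field; rewrite !gt_eqF// addr_gt0.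
  rewrite ler_wpM2l ?(ltW s0)// lef_pV2 ?posrE ?mulr_gt0 ?exprn_gt0 ?ltr_wpDr//.
  by rewrite expr2 ler_wpM2r ?addr_ge0 ?(ltW s0)// lerD2l ler_nat.
have v0 : 0 < s^-1 / (1 + x) ^+ 2.
  by rewrite divr_gt0 ?invr_gt0 ?exprn_gt0 ?addr_gt0.
move/(ler_log2 v0).
rewrite log2M ?invr_gt0 ?exprn_gt0 ?addr_gt0// !log2V ?exprn_gt0 ?addr_gt0//.
rewrite log2X ?addr_gt0// => hw.
have hx : log2 (1 + x) <= x / ln 2.
  rewrite /log2 ler_wpM2r ?invr_ge0 ?(ltW ln2_gt0)//.
  by apply: le_ln1Dx; lra.
have xb : 2 * x <= 3 + 2 * j%:R ^+ 2 / s ^+ 2.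
  have hi : 0 < s^-1 <= 1 by rewrite invr_gt0 s0 invf_le1.
  have -> : 2 * j%:R ^+ 2 / s ^+ 2 = 2 * (j%:R / s) ^+ 2 :> R.
    by field; rewrite gt_eqF.
  have -> : x = j%:R / s + s^-1 by rewrite /x -natr1 mulrDl mul1r.
  by have := sqr_ge0 (j%:R / s - 2^-1); nra.
have := ler_wpM2r (ltW (_ : 0 < (ln 2)^-1)) xb; rewrite invr_gt0 ln2_gt0.
move=> /(_ isT); lra.
Qed.

End Subdistributions.

Section Chain.
Context {R : realType}.

(** Group the sum by the value of [A]: each class contributes at most [w] of that value, and the
    values are distinct. This peels one factor off a product of conditional laws. *)
Lemma subdist_chain (F : finType) (X : eqType) (P : pred F) (A : F -> X)
    (w : X -> R) (g : F -> R) :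
  subdist w -> (forall f, 0 <= g f) ->
  (forall f0, P f0 -> \sum_(f | P f && (A f == A f0)) g f <= 1) ->
  \sum_(f | P f) w (A f) * g f <= 1.
Proof.
move=> [w0 w1] g0 gP.
(* A canonical representative of each class, so that the classes are indexed by elements of the
   finite type [F]. *)
pose rep f := odflt f [pick f' | P f' && (A f' == A f)].
have repP f : P f -> P (rep f) /\ A (rep f) = A f.
  move=> Pf; rewrite /rep; case: pickP => [f' /andP[? /eqP]//|/(_ f)].
  by rewrite Pf eqxx.
have rep_eq f f' : P f -> A f = A f' -> rep f = rep f'.
  move=> Pf AA; rewrite /rep AA; case: pickP => // /(_ f).
  by rewrite Pf AA eqxx.
rewrite (partition_big rep P)/=; last by move=> f /repP[].
pose u := [seq j <- index_enum F | P j && (rep j == j)].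
have uP j : j \in u -> P j /\ rep j = j.
  by rewrite mem_filter => /andP[/andP[-> /eqP ->]].
apply: (@le_trans _ _ (\sum_(j <- u) w (A j))).
  rewrite big_filter /= [leRHS]big_mkcondr/=.
  apply: ler_sum => j Pj; case: ifPn => [/eqP rj|rj].
    rewrite (eq_bigr (fun f => w (A j) * g f)); last first.
      by move=> f /andP[Pf /eqP <-]; have [_ ->] := repP f Pf.
    rewrite -big_distrr /= ler_piMr//; apply: le_trans (gP _ Pj).
    rewrite [leRHS](eq_bigl (fun f => P f && (rep f == j))) // => f.
    apply: andb_id2l => Pf; apply/eqP/eqP => [AA|<-]; last by have [_ ->] := repP f Pf.
    by rewrite (rep_eq _ _ Pf AA).
  rewrite big1// => f /andP[Pf /eqP fj]; case/negP: rj; apply/eqP.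
  by have [Pr Ar] := repP f Pf; rewrite -{1}fj (rep_eq _ _ Pr Ar).
rewrite -(big_map A xpredT); apply: w1.
rewrite map_inj_in_uniq ?filter_uniq ?index_enum_uniq// => i j /uP[Pi <-] /uP[Pj <-].
have [Pri ->] := repP i Pi; have [Prj ->] := repP j Pj.
exact: rep_eq.
Qed.

(** Induction on [s]: after a factor is peeled off, agreement on its feature is absorbed into
    [P]. *)
Lemma subdist_chain_seq (F : finType) (I X : eqType) (s : seq I)
    (A : I -> F -> X) (w : I -> X -> R) (g : F -> R) (P : pred F) :
  (forall i, i \in s -> subdist (w i)) -> (forall f, 0 <= g f) ->
  (forall f0, P f0 ->
     \sum_(f | P f && all (fun i => A i f == A i f0) s) g f <= 1) ->
  \sum_(f | P f) (\prod_(i <- s) w i (A i f)) * g f <= 1.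
Proof.
elim: s P => [|i s IH] P ws g0 gP.
  case: (pickP P) => [f0 Pf0|P0]; last by rewrite big_pred0.
  have := gP f0 Pf0; rewrite (eq_bigl P) => [|f]; last by rewrite /= andbT.
  by under [in X in _ -> X]eq_bigr do rewrite big_nil mul1r.
have wi : subdist (w i) by apply: ws; rewrite mem_head.
have ws' j : j \in s -> subdist (w j) by move=> js; apply: ws; rewrite inE js orbT.
under eq_bigr do rewrite big_cons -mulrA.
apply: subdist_chain => //.
  move=> f; rewrite mulr_ge0//.
  rewrite big_seq; apply: prodr_ge0 => j js; by have [+ _] := ws' j js; apply.
move=> f0 Pf0; apply: (IH (fun f => P f && (A i f == A i f0))) => //.
move=> f1 /andP[Pf1 /eqP A1]; apply: le_trans (gP f1 Pf1) => /=.
rewrite A1 le_eqVlt; apply/orP; left; apply/eqP; apply: eq_bigl => f.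
by rewrite andbA.
Qed.

(** The tangent bound [ln t <= t - 1] at [t = n * Q f], summed over [f]. *)
Lemma gibbs_uniform (F : finType) (Q : F -> R) :
  (0 < #|F|)%N -> (forall f, 0 < Q f) -> \sum_f Q f <= 1 ->
  log2 #|F|%:R <= (\sum_f - log2 (Q f)) / #|F|%:R.
Proof.
move=> F0 Q0 Q1; set n : R := #|F|%:R.
have n0 : 0 < n by rewrite ltr0n.
have H f : ln (Q f) <= n * Q f - 1 - ln n.
  rewrite lerBrDr -lnM ?posrE//.
  have -> : Q f * n = 1 + (n * Q f - 1) by ring.
  by apply: le_ln1Dx; have := mulr_gt0 n0 (Q0 f); lra.
have : \sum_f ln (Q f) <= - (n * ln n).
  apply: (le_trans (ler_sum _ (fun f _ => H f))).
  rewrite !big_split /= -big_distrr /= !sumr_const.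
  rewrite -[_ *+ #|_|]mulr_natl -[X in _ + X]mulr_natl -/n.
  by have := ler_wpM2l (ltW n0) Q1; lra.
set S := \sum_f ln (Q f) => SE.
have -> : \sum_f - log2 (Q f) = - S / ln 2 by rewrite sumrN -big_distrl mulNr.
rewrite ler_pdivlMr// /log2 mulrAC ler_pM2r ?invr_gt0 ?ln2_gt0//; lra.
Qed.

Definition empirical (T : finType) (X : eqType) (g : T -> X) (a : X) : R :=
  #|[pred x | g x == a]|%:R / #|T|%:R.

Lemma subdist_empirical (T : finType) (X : eqType) (g : T -> X) :
  (0 < #|T|)%N -> subdist (empirical g).
Proof.
move=> T0; split=> [a|s us]; first by rewrite divr_ge0.
rewrite -big_distrl /= ler_pdivrMr ?ltr0n// mul1r -natr_sum ler_nat.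
under eq_bigr do rewrite -sum1_card big_mkcond /=.
rewrite exchange_big /= -sum1_card; apply: leq_sum => x _.
under eq_bigr do rewrite inE.
rewrite -big_mkcond /= sum1_count.
by rewrite (eq_count (a2 := pred1 (g x))) ?count_uniq_mem ?leq_b1// => a; rewrite /= eq_sym.
Qed.

Lemma empirical_gt0 (T : finType) (X : eqType) (g : T -> X) (x : T) :
  0 < empirical g (g x).
Proof.
rewrite divr_gt0// ltr0n; apply/card_gt0P; exists x => //.
by rewrite inE /=.
Qed.

(** Coding a cache content by its own law costs its entropy on average; this is where the cache size
    constraint enters. *)
Lemma entropy_empirical (T : finType) (X : eqType) (g : T -> X) :
  entropy R g = (\sum_x - log2 (empirical g (g x))) / #|T|%:R.
Proof.
have cardE a : #|[set x | g x == a]| = #|[pred x | g x == a]|.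
  by apply: eq_card => x; rewrite [RHS]inE; apply/idP/idP => [/set_mem//|/mem_set].
rewrite /entropy -sumrN big_distrl /=.
pose h a := - log2 (empirical g a) / #|T|%:R.
rewrite [RHS](eq_bigr (fun x => h (g x)))//.
transitivity (\sum_(a <- undup (codom g)) \sum_x if g x == a then h a else 0).
  apply: eq_bigr => a _; rewrite -big_mkcond /= sumr_const cardE.
  rewrite -/(empirical g a); transitivity (#|[pred x | g x == a]|%:R * h a).
    by rewrite /h {1}/empirical; ring.
  by rewrite mulr_natl.
rewrite exchange_big /=; apply: eq_bigr => x _.
rewrite (bigD1_seq (g x)) ?undup_uniq ?mem_undup ?codom_f//= eqxx.
by rewrite big1 ?addr0// => a /negPf; rewrite eq_sym => ->.
Qed.

(** Reduces an average over libraries to one over a single file: a product whose factors away from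
    [i] are 1 is distributed over the sum. *)
Lemma sum_ffun_coord (I T : finType) (i : I) (g : T -> R) :
  (0 < #|T|)%N ->
  (\sum_(f : {ffun I -> T}) g (f i)) / #|{ffun I -> T}|%:R =
  (\sum_x g x) / #|T|%:R.
Proof.
move=> T0.
have Tn0 : #|T|%:R != 0 :> R by rewrite pnatr_eq0 -lt0n.
have := bigA_distr_bigA (zero := 0 : R) (one := 1) (times := *%R) (plus := +%R)
  (fun j x => if j == i then g x else 1).
have L : \prod_j \sum_x (if j == i then g x else 1) =
    (\sum_x g x) * #|T|%:R ^+ #|[pred j | j != i]|.
  rewrite (bigD1 i)//= eqxx -prodr_const; congr (_ * _).
  by apply: eq_bigr => j /negPf ->; rewrite sumr_const.
rewrite L.
have E (f : {ffun I -> T}) : \prod_j (if j == i then g (f j) else 1) = g (f i).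
  by rewrite (bigD1 i)//= eqxx big1 ?mulr1// => j /negPf ->.
under [in X in _ = X -> _]eq_bigr do rewrite E.
move=> <-; rewrite card_ffun natrX.
have -> : #|I| = (#|[pred j | j != i]|).+1 by rewrite cardC1 prednK//; apply/card_gt0P; exists i.
by rewrite exprS invfM mulrACA divff ?mulr1// expf_neq0.
Qed.

End Chain.

(** * Decoding with a perturbed signal *)

Section Decoding.
Context (R : realType) (d : measure_display) (Omega : measurableType d)
  (Pr : probability Omega R).

Definition hit_prob (T L : nat) (dec : T.-tuple R[i] -> file L)
    (y : Omega -> T.-tuple R[i]) (x : file L) : R :=
  fine (Pr [set w | dec (y w) = x]).

Lemma hit_prob_ge0 (T L : nat) (dec : T.-tuple R[i] -> file L)
    (y : Omega -> T.-tuple R[i]) (x : file L) : 0 <= hit_prob dec y x.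
Proof. by rewrite fine_ge0. Qed.

Lemma sum_hit_prob (T L : nat) (dec : T.-tuple R[i] -> file L)
    (y : Omega -> T.-tuple R[i]) :
  (forall x, measurable [set v | dec v = x]) -> measurable_fun [set: Omega] y ->
  \sum_x hit_prob dec y x <= 1.
Proof.
move=> mdec my.
have mA x : measurable [set w | dec (y w) = x].
  rewrite -[X in measurable X]setTI; exact: (my measurableT _ (mdec x)).
rewrite -lee_fin -sumEFin.
rewrite /hit_prob; under eq_bigr do rewrite fineK ?fin_num_measure//.
rewrite -(@measure_bigsetU_ord _ _ _ Pr _ xpredT)//=; last first.
  by move=> i j _ _ [w [/= <- <-]].
by apply: probability_le1; exact: bigsetU_measurable.
Qed.

(** The added [(2 ^+ L)^-1] caps the cost at [L + 1] bits, which makes the bound linear in the error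
    probability even when decoding is unreliable. *)
Lemma decode_cost (L T : nat) (dec : T.-tuple R[i] -> file L)
    (X : nat -> {RV Pr >-> R[i]}) (X_indep : mutually_independent X)
    (X_gaussian : forall t, std_complex_gaussian (X t))
    (C : R) (C_ge0 : 0 <= C) (u v : 'I_T -> R[i])
    (uvRe : forall t, `|complex.Re (u t - v t)| <= C)
    (uvIm : forall t, `|complex.Im (u t - v t)| <= C)
    (x : file L) (mdec : measurable [set y | dec y = x]) :
  - log2 ((hit_prob dec (fun w => [tuple v t + X t w *+ 2 | t < T]) x
           + (2 ^+ L)^-1) / 2) <=
  2 + T%:R * log2 ((2 * expR (C ^+ 2)) ^+ 2)
    + 2 * fine (Pr [set w | dec [tuple u t + X t w | t < T] <> x]) * L%:R.
Proof.
set g := hit_prob _ _ _; set e := fine _.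
set c : R := (2 * expR (C ^+ 2)) ^+ 2.
have c1 : 1 <= c.
  have : 1 <= expR (C ^+ 2) by rewrite -expR0 ler_expR sqr_ge0.
  rewrite /c => h; rewrite exprn_ege1//; lra.
have c0 : 0 < c by exact: lt_le_trans c1.
have lc : 0 <= T%:R * log2 c.
  by rewrite mulr_ge0// divr_ge0 ?(ltW (ln2_gt0))// ln_ge0.
have e0 : 0 <= e by rewrite fine_ge0.
have g0 : 0 <= g by exact: hit_prob_ge0.
have p0 : 0 < (2 ^+ L)^-1 :> R by rewrite invr_gt0 exprn_gt0.
have mu_ : measurable [set w | dec [tuple u t + X t w | t < T] = x].
  have my : measurable_fun [set: Omega] (fun w => [tuple u t + X t w | t < T]).
    apply: measurable_fun_mktuple => t.
    by apply: measurable_fun_complexD => //; exact: measurable_funPT.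
  by rewrite -[X in measurable X]setTI; exact: (my measurableT _ mdec).
(* If the error exceeds 1/2, the cap suffices because [L <= 2 * e * L]. Otherwise the domination of
   the shifted noise gives a hit probability of at least [(c ^+ T)^-1 / 2]. *)
have [eh|eh] := leP e 2^-1; last first.
  have : - log2 ((g + (2 ^+ L)^-1) / 2) <= 1 + L%:R.
    rewrite lerNl; apply: (le_trans _ (ler_log2 (x := (2 ^+ L)^-1 / 2) _ _)).
    - rewrite log2M ?invr_gt0// !log2V// ?log2_2 ?log2X// log2_2; lra.
    - by rewrite divr_gt0.
    - by rewrite ler_wpM2r ?invr_ge0// lerDr.
  move=> h; apply: (le_trans h).
  have : L%:R <= 2 * e * L%:R by rewrite ler_peMl//; lra.
  lra.
have hg : 1 - e <= c ^+ T * g.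
  have := @gaussian_tuple_shift_le _ _ _ Pr T X X_indep X_gaussian C C_ge0
    u v uvRe uvIm _ mdec.
  rewrite -/c /= => h.
  have mv : measurable [set w | dec [tuple v t + X t w *+ 2 | t < T] = x].
    have my : measurable_fun [set: Omega] (fun w => [tuple v t + X t w *+ 2 | t < T]).
      apply: measurable_fun_mktuple => t.
      apply: measurable_fun_complexD => //.
      by apply: measurable_fun_complexD => //; exact: measurable_funPT.
    by rewrite -[X in measurable X]setTI; exact: (my measurableT _ mdec).
  rewrite -lee_fin EFinM /g /hit_prob fineK ?fin_num_measure//.
  apply: le_trans h; rewrite EFinB fineK; last first.
    by rewrite fin_num_measure//; exact: measurableC.
  by rewrite -(probability_setC _ (measurableC mu_)) setCK.
clearbody c e g.
have cT0 : 0 < (c ^+ T)^-1 by rewrite invr_gt0 exprn_gt0.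
have hg' : (c ^+ T)^-1 / 2 <= g.
  by rewrite ler_pdivrMl ?exprn_gt0//; lra.
have : - log2 ((g + (2 ^+ L)^-1) / 2) <= 2 + T%:R * log2 c.
  rewrite lerNl; apply: (le_trans _ (ler_log2 (x := (c ^+ T)^-1 / 2 / 2) _ _)).
  - rewrite !log2M ?invr_gt0 ?divr_gt0 ?exprn_gt0// !log2V ?exprn_gt0//.
    rewrite log2X// log2_2; lra.
  - by rewrite !divr_gt0.
  - by rewrite ler_wpM2r ?invr_ge0//; lra.
have : 0 <= 2 * e * L%:R by rewrite !mulr_ge0.
lra.
Qed.
End Decoding.

(** * Complex moduli and rounding to the integer grid *)

Section ComplexBounds.
Context {R : realType}.
Implicit Types x y : R[i].
Notation nc := Normc.normc.

Lemma normc_ge0 x : 0 <= nc x.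
Proof. by case: x => a b; rewrite sqrtr_ge0. Qed.

Lemma sqr_normcE x : nc x ^+ 2 = complex.Re x ^+ 2 + complex.Im x ^+ 2.
Proof. by case: x => a b; rewrite sqr_sqrtr ?addr_ge0 ?sqr_ge0. Qed.

Lemma Re_le_normc x : `|complex.Re x| <= nc x.
Proof.
rewrite -(@ler_pXn2r _ 2)// ?nnegrE ?normc_ge0// real_normK ?num_real//.
by rewrite sqr_normcE lerDl sqr_ge0.
Qed.

Lemma Im_le_normc x : `|complex.Im x| <= nc x.
Proof.
rewrite -(@ler_pXn2r _ 2)// ?nnegrE ?normc_ge0// real_normK ?num_real//.
by rewrite sqr_normcE lerDr sqr_ge0.
Qed.

Lemma normc_le_ReIm x : nc x <= `|complex.Re x| + `|complex.Im x|.
Proof.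
rewrite -(@ler_pXn2r _ 2)// ?nnegrE ?normc_ge0 ?addr_ge0//.
rewrite sqr_normcE sqrrD !real_normK ?num_real// lerD2r lerDl.
by rewrite mulrn_wge0// mulr_ge0.
Qed.

Lemma normc_sum (I : Type) (s : seq I) (P : pred I) (F : I -> R[i]) :
  nc (\sum_(i <- s | P i) F i) <= \sum_(i <- s | P i) nc (F i).
Proof.
apply: (big_ind2 (fun (a : R[i]) (b : R) => nc a <= b)) => //.
  by rewrite Normc.normc0.
by move=> a b c e ab ce; rewrite (le_trans (le_normcD _ _))// lerD.
Qed.

(** Cauchy-Schwarz, from [2 a b <= a ^+ 2 + b ^+ 2] over all pairs. *)
Lemma sqr_sum_le (n : nat) (a : 'I_n -> R) :
  (\sum_i a i) ^+ 2 <= n%:R * \sum_i a i ^+ 2.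
Proof.
have -> : n%:R * (\sum_i a i ^+ 2) =
    \sum_i \sum_j (a i ^+ 2 + a j ^+ 2) / 2.
  rewrite [RHS](eq_bigr (fun i => (n%:R * a i ^+ 2 + \sum_j a j ^+ 2) / 2)).
    rewrite -big_distrl /= big_split /= -big_distrr /= sumr_const card_ord.
    by rewrite -[X in _ + X]mulr_natl; field.
  by move=> i _; rewrite -big_distrl /= big_split /= sumr_const card_ord mulr_natl.
rewrite expr2 big_distrl /=; apply: ler_sum => i _.
rewrite big_distrr /=; apply: ler_sum => j _.
by rewrite ler_pdivlMr//; have := sqr_ge0 (a i - a j); lra.
Qed.

(** Rounding towards zero, so that the result is encoded by two naturals: a sign bit and the integer
    part of the absolute value. *)
Definition quant (x : R) : R :=
  if x < 0 then - (Num.truncn `|x|)%:R else (Num.truncn `|x|)%:R.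

Lemma quant_close (x : R) : `|x - quant x| <= 1.
Proof.
have /andP[h1 h2] := truncn_itv (normr_ge0 x).
move: h1 h2; rewrite -natr1 /quant; set n : R := _%:R.
have [x0|x0] := ltP x 0.
  by rewrite ltr0_norm// => h1 h2; rewrite ler_norml; lra.
by rewrite ger0_norm// => h1 h2; rewrite ler_norml; lra.
Qed.

Lemma quant_eq (x y : R) : (x < 0) = (y < 0) ->
  Num.truncn `|x| = Num.truncn `|y| -> quant x = quant y.
Proof. by rewrite /quant => -> ->. Qed.

End ComplexBounds.

(** * Signal estimates and received power *)

Section Estimates.
Context {R : realType} {M K N L : nat}.
Variables (p : policy R M K N L) (H : channel R K M) (D : demand K N).
Variables (V U : {set 'I_K}) (S : {set 'I_M}) (B : 'I_K -> 'I_K -> R[i]).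
Implicit Types f : library N L.

Definition signal f k t : R[i] :=
  \sum_m H k m * tnth (codeword p f D H m) t.

Definition side f k t : R[i] :=
  \sum_(m | m \notin S) H k m * tnth (codeword p f D H m) t.

Definition qsignal f k t : R[i] :=
  Complex (quant (complex.Re (signal f k t))) (quant (complex.Im (signal f k t))).

(* What the genie-aided receiver knows of the noiseless signal of user [k]. *)
Definition estimate f k t : R[i] :=
  if k \in U then qsignal f k t
  else side f k t + \sum_(u in U) B k u * (qsignal f u t - side f u t).

(** Each 2 is a rounding error. Summing over all users gives a radius that depends on [B] only, not
    on the policy, the files or the time. *)
Definition estimate_radius : R := 2 + \sum_k \sum_u Normc.normc (B k u) * 2.

Lemma qsignal_close f k t : Normc.normc (signal f k t - qsignal f k t) <= 2.
Proof.
apply: (le_trans (normc_le_ReIm _)); rewrite /qsignal.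
have := quant_close (complex.Re (signal f k t)).
have := quant_close (complex.Im (signal f k t)).
by case: (signal f k t) => a b /= h1 h2; rewrite (natrD _ 1 1) lerD.
Qed.

Hypothesis rowsB : forall k m, k \in V -> m \in S ->
  H k m = \sum_(u in U) B k u * H u m.

(** By [rowsB] the part of a signal sent from [S] is the [B]-combination of the same parts for the
    users in [U], so the error is that combination of their rounding errors. *)
Lemma estimate_close f k t : k \in V ->
  Normc.normc (signal f k t - estimate f k t) <= estimate_radius.
Proof.
move=> kV; have r0 (A : pred 'I_K) k' :
    0 <= \sum_(u | A u) Normc.normc (B k' u) * 2.
  by apply: sumr_ge0 => u _; rewrite mulr_ge0// normc_ge0.
rewrite /estimate; case: ifPn => kU.
  by apply: (le_trans (qsignal_close _ _ _)); rewrite lerDl sumr_ge0.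
have E k' : signal f k' t = side f k' t +
    \sum_(m in S) H k' m * tnth (codeword p f D H m) t.
  by rewrite /signal (bigID (fun m => m \notin S))/=; congr (_ + _);
    apply: eq_bigl => m; rewrite negbK.
have -> : signal f k t - (side f k t +
      \sum_(u in U) B k u * (qsignal f u t - side f u t)) =
    \sum_(u in U) B k u * (signal f u t - qsignal f u t).
  have -> : signal f k t = side f k t +
      \sum_(u in U) B k u * (signal f u t - side f u t).
    rewrite E; congr (_ + _).
    under eq_bigr => m mS do rewrite rowsB// big_distrl /=.
    rewrite exchange_big /=; apply: eq_bigr => u uU.
    rewrite E addrC addKr big_distrr /=.
    by apply: eq_bigr => m _; rewrite mulrA.
  rewrite opprD addrACA subrr add0r -sumrB; apply: eq_bigr => u _.
  by rewrite -mulrBr opprB addrA subrK.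
apply: (le_trans (normc_sum _ _ _)).
apply: (@le_trans _ _ (\sum_(u in U) Normc.normc (B k u) * 2)).
  by apply: ler_sum => u _; rewrite Normc.normcM ler_wpM2l ?normc_ge0// qsignal_close.
apply: (@le_trans _ _ (\sum_u Normc.normc (B k u) * 2)).
  rewrite [leRHS](bigID (mem U))/= lerDl; exact: r0.
rewrite /estimate_radius [X in _ <= _ + X](bigD1 k)//=.
have : 0 <= \sum_(i < K | i != k) \sum_u Normc.normc (B i u) * 2.
  by apply: sumr_ge0 => i _; exact: r0.
by rewrite addrCA lerDl => h; rewrite addr_ge0.
Qed.

Definition channel_energy : R := \sum_k \sum_m Normc.normc (H k m) ^+ 2.

Lemma channel_energy_ge0 : 0 <= channel_energy.
Proof. by apply: sumr_ge0 => k _; apply: sumr_ge0 => m _; rewrite sqr_ge0. Qed.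

Lemma sqr_normc_signal_le f k t :
  Normc.normc (signal f k t) ^+ 2 <= M%:R * channel_energy *
    \sum_m Normc.normc (tnth (codeword p f D H m) t) ^+ 2.
Proof.
have h : Normc.normc (signal f k t) <=
    \sum_m Normc.normc (H k m) * Normc.normc (tnth (codeword p f D H m) t).
  by apply: (le_trans (normc_sum _ _ _)); apply: ler_sum => m _; rewrite Normc.normcM.
apply: (@le_trans _ _ ((\sum_m Normc.normc (H k m) *
    Normc.normc (tnth (codeword p f D H m) t)) ^+ 2)).
  by rewrite lerXn2r// nnegrE ?normc_ge0// (le_trans _ h)// normc_ge0.
apply: (le_trans (sqr_sum_le _)).
rewrite -mulrA ler_wpM2l// big_distrr /=; apply: ler_sum => m _.
rewrite exprMn ler_wpM2r ?sqr_ge0//.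
rewrite /channel_energy (bigD1 k)//= (bigD1 m)//=.
rewrite -addrA lerDl addr_ge0//; first by apply: sumr_ge0 => ? _; rewrite sqr_ge0.
by apply: sumr_ge0 => ? _; apply: sumr_ge0 => ? _; rewrite sqr_ge0.
Qed.

Lemma average_signal_power mu CF pow k : admissible p mu CF pow ->
  (\sum_f \sum_t Normc.normc (signal f k t) ^+ 2) / #|library N L|%:R <=
  M%:R * channel_energy * (M%:R * ((TE p)%:R * pow)).
Proof.
move=> [_ _ power _].
have c0 : 0 <= M%:R * channel_energy by rewrite mulr_ge0// channel_energy_ge0.
apply: (@le_trans _ _ (M%:R * channel_energy * \sum_m
    ((\sum_f \sum_t Normc.normc (tnth (codeword p f D H m) t) ^+ 2)
      / #|library N L|%:R))).
  rewrite -big_distrl /= mulrA ler_wpM2r ?invr_ge0//.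
  rewrite [leRHS]mulrC [X in X * _]exchange_big /= mulrC [leRHS]big_distrr /=.
  apply: ler_sum => f _.
  rewrite [leRHS]mulrC [X in _ <= X * _]exchange_big /= mulrC [leRHS]big_distrr /=.
  by apply: ler_sum => t _; exact: sqr_normc_signal_le.
rewrite ler_wpM2l//; apply: (le_trans (ler_sum _ (fun m _ => power D H m))).
by rewrite sumr_const card_ord -[_ *+ M]mulr_natl.
Qed.

End Estimates.

Arguments signal {R M K N L} p H D f k t.
Arguments side {R M K N L} p H D S f k t.
Arguments qsignal {R M K N L} p H D f k t.
Arguments estimate {R M K N L} p H D U S B f k t.

(** * The weight of a library *)

Lemma subdist_chain_cond (R : realType) (F I : finType) (X : eqType)
    (J : pred I) (A : I -> F -> X) (w : I -> X -> R) (g : F -> R) (P : pred F) :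
  (forall i, J i -> subdist (w i)) -> (forall f, 0 <= g f) ->
  (forall f0, P f0 ->
     \sum_(f | P f && [forall i, J i ==> (A i f == A i f0)]) g f <= 1) ->
  \sum_(f | P f) (\prod_(i | J i) w i (A i f)) * g f <= 1.
Proof.
move=> wJ g0 gP; under eq_bigr do rewrite -big_filter.
apply: subdist_chain_seq => //.
  by move=> i; rewrite mem_filter => /andP[/wJ].
move=> f0 Pf0; rewrite (eq_bigl _ _ (_ : _ =1
    (fun f => P f && [forall i, J i ==> (A i f == A i f0)]))); first exact: gP.
move=> f; congr (_ && _); apply/allP/forallP => [h i|h i].
  by apply/implyP => Ji; apply: h; rewrite mem_filter Ji mem_index_enum.
by rewrite mem_filter => /andP[Ji _]; exact: (implyP (h i)).
Qed.

Section Converse.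
Context {R : realType} {M K N L : nat}.
Context (d : measure_display) (Omega : measurableType d)
  (Pr : probability Omega R) (z : 'I_K * nat -> {RV Pr >-> R[i]}).
Variables (p : policy R M K N L) (H : channel R K M) (D : demand K N).
Variables (V U : {set 'I_K}) (S : {set 'I_M}) (B : 'I_K -> 'I_K -> R[i]).
Variables (mu CF pow : R).
Hypothesis p_adm : admissible p mu CF pow.
Implicit Types f : library N L.

Let unrequested n := [forall k, (k \in V) ==> (D k != n)].

(* In an index [(k, t, (c, b))], [c] selects the real or the imaginary part and
   [b] selects the sign or the integer part of its absolute value. *)
Let coord (i : 'I_K * 'I_(TE p) * (bool * bool)) f : R :=
  (if i.2.1 then @complex.Re R else @complex.Im R)
    (signal p H D f i.1.1 i.1.2).

Let signal_feature i f : nat :=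
  if i.2.2 then nat_of_bool (coord i f < 0) else Num.truncn `|coord i f|.

(** Signs get the uniform law on two values; integer parts get the heavy tail at the scale of the
    signal amplitude. *)
Let signal_weight (i : 'I_K * 'I_(TE p) * (bool * bool)) : nat -> R :=
  if i.2.2 then (fun x => if x.+1%:R <= 2 :> R then 2^-1 else 0)
  else heavy_tail (Num.sqrt pow).

Let cached (i : 'I_M * 'I_K) := [&& i.1 \notin S, i.2 \in V & i.2 \notin U].

Let cache_feature (i : 'I_M * 'I_K) f : nat := pi_c p i.1 (D i.2) (f (D i.2)).

Let fronthaul_weight (x : nat) : R :=
  if x.+1%:R <= 2 `^ ((TF p)%:R * CF) then (2 `^ ((TF p)%:R * CF))^-1 else 0.

(** Mixing in the uniform law keeps the weight positive for files that the decoder never outputs. *)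
Let decode_weight (k : 'I_K) (e : 'I_(TE p) -> R[i]) (x : file L) : R :=
  (hit_prob Pr (fun y => pi_d p k y (D k) H)
     (fun w => [tuple e t + z (k, val t) w *+ 2 | t < TE p]) x
   + (2 ^+ L)^-1) / 2.

Let user_weight f k : R := decode_weight k (estimate p H D U S B f k) (f (D k)).

(** The factors are nested in the order in which the genie-aided receiver learns the library; the
    final 1 is the base case of the peeling. *)
Let code_weight f : R :=
  (\prod_(n | unrequested n) (2 ^+ L)^-1) *
  ((\prod_(i | i.1.1 \in U) signal_weight i (signal_feature i f)) *
  ((\prod_(i | cached i) empirical (pi_c p i.1 (D i.2)) (cache_feature i f)) *
  ((\prod_(m | m \notin S) fronthaul_weight (fronthaul p f D H m)) *
  ((\prod_(k | k \in U) user_weight f k) *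
  ((\prod_(k | (k \in V) && (k \notin U)) user_weight f k) * 1))))).

Lemma card_file : #|file L| = (2 ^ L)%N.
Proof. by rewrite card_ord. Qed.

Lemma file_weight_gt0 : 0 < (2 ^+ L)^-1 :> R.
Proof. by rewrite invr_gt0 exprn_gt0. Qed.

Lemma sum_file_weight : \sum_(x : file L) (2 ^+ L)^-1 = 1 :> R.
Proof.
by rewrite sumr_const card_file -[_ *+ _]mulr_natl natrX mulfV.
Qed.

Lemma decode_weight_ge k e x : (2 ^+ L)^-1 / 2 <= decode_weight k e x.
Proof. by rewrite ler_wpM2r ?invr_ge0// lerDr hit_prob_ge0. Qed.

Lemma decode_weight_gt0 k e x : 0 < decode_weight k e x.
Proof.
apply: lt_le_trans (decode_weight_ge k e x).
by rewrite divr_gt0 ?file_weight_gt0.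
Qed.

Lemma subdist_decode_weight k e : subdist (decode_weight k e).
Proof.
apply: subdist_fin => [x|]; first exact/ltW/decode_weight_gt0.
rewrite -big_distrl big_split /= sum_file_weight.
have := @sum_hit_prob R d Omega Pr _ _ (fun y => pi_d p k y (D k) H)
  (fun w => [tuple e t + z (k, val t) w *+ 2 | t < TE p]).
rewrite ler_pdivrMr// mul1r => h; rewrite (natrD _ 1 1) lerD2r; apply: h.
  by move=> x; have [_ _ _] := p_adm; apply.
apply: measurable_fun_mktuple => t.
apply: measurable_fun_complexD => //.
by apply: measurable_fun_complexD => //; exact: measurable_funPT.
Qed.

Hypothesis pow_ge1 : 1 <= pow.

Let sqrt_pow_ge1 : 1 <= Num.sqrt pow.
Proof. by rewrite -(@sqrtr1 R) ler_wsqrtr. Qed.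

Lemma subdist_signal_weight i : subdist (signal_weight i).
Proof.
rewrite /signal_weight; case: ifP => _; first exact: subdist_uniform.
by apply: subdist_heavy_tail; exact: lt_le_trans sqrt_pow_ge1.
Qed.

Lemma signal_weight_gt0 i f : 0 < signal_weight i (signal_feature i f).
Proof.
rewrite /signal_weight /signal_feature; case: ifP => _.
  rewrite ler_nat ltnS (_ : (_ <= 1)%N); last by case: (_ < 0).
  by rewrite invr_gt0.
by apply: heavy_tail_gt0; exact: lt_le_trans sqrt_pow_ge1.
Qed.

Lemma fronthaul_weightE f m :
  fronthaul_weight (fronthaul p f D H m) = (2 `^ ((TF p)%:R * CF))^-1.
Proof. by have [_ h _ _] := p_adm; rewrite /fronthaul_weight h. Qed.

Lemma code_weight_gt0 f : 0 < code_weight f.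
Proof.
rewrite /code_weight !mulr_gt0//; apply: prodr_gt0 => i _.
- exact: file_weight_gt0.
- exact: signal_weight_gt0.
- exact: empirical_gt0.
- by rewrite fronthaul_weightE invr_gt0 powR_gt0.
- exact: decode_weight_gt0.
- exact: decode_weight_gt0.
Qed.

Hypothesis UV : U \subset V.

(** Every file is unrequested, requested by a user in [U], or requested in [V] outside [U]; in the
    last case the cached part is known. So the whole cache of [m] is fixed. *)
Lemma codeword_eq f f' m : m \notin S ->
  (forall n, unrequested n -> f n = f' n) ->
  (forall i, cached i -> cache_feature i f = cache_feature i f') ->
  fronthaul p f D H m = fronthaul p f' D H m ->
  (forall k, k \in U -> f (D k) = f' (D k)) ->
  codeword p f D H m = codeword p f' D H m.
Proof.
move=> mS f1 f3 f4 f5; rewrite /codeword f4.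
suff -> : cache p f m = cache p f' m by [].
apply/funext => n; rewrite /cache.
have [/f1 -> //|] := boolP (unrequested n).
rewrite negb_forall => /existsP[k]; rewrite negb_imply negbK => /andP[kV /eqP <-].
have [/f5 -> //|kU] := boolP (k \in U).
by apply: (f3 (m, k)); rewrite /cached /= mS kV.
Qed.

(** Each factor is a subdistribution once the features before it are fixed, so the factors are
    peeled off from the outside; in the end one library is left. *)
Lemma sum_code_weight : \sum_f code_weight f <= 1.
Proof.
have ge0 (a b : R) : 0 <= a -> 0 <= b -> 0 <= a * b by exact: mulr_ge0.
have uw0 f k : 0 <= user_weight f k by exact/ltW/decode_weight_gt0.
have q6 f : 0 <= (\prod_(k | (k \in V) && (k \notin U)) user_weight f k) * 1.
  by rewrite mulr1 prodr_ge0.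
have q5 f : 0 <= (\prod_(k | k \in U) user_weight f k) *
    ((\prod_(k | (k \in V) && (k \notin U)) user_weight f k) * 1).
  by rewrite ge0// prodr_ge0.
have q4 f : 0 <= (\prod_(m | m \notin S) fronthaul_weight (fronthaul p f D H m)) *
    ((\prod_(k | k \in U) user_weight f k) *
    ((\prod_(k | (k \in V) && (k \notin U)) user_weight f k) * 1)).
  by rewrite ge0// prodr_ge0// => m _; rewrite fronthaul_weightE invr_ge0 powR_ge0.
rewrite /code_weight.
apply: (subdist_chain_cond (A := fun n f => f n) (w := fun _ _ => (2 ^+ L)^-1)
  (P := xpredT)).
- move=> _ _; apply: subdist_fin => [x|]; first exact/ltW/file_weight_gt0.
  by rewrite sum_file_weight.
- move=> f; rewrite ge0//.
    by rewrite prodr_ge0// => i _; exact/ltW/signal_weight_gt0.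
  by rewrite ge0// prodr_ge0// => i _; exact/ltW/empirical_gt0.
move=> f1 _; apply: (subdist_chain_cond (A := signal_feature) (w := signal_weight)) => [i _|f|].
- exact: subdist_signal_weight.
- by rewrite ge0// prodr_ge0// => i _; exact/ltW/empirical_gt0.
move=> f2 Pf2; apply: (subdist_chain_cond (A := cache_feature)
  (w := fun i => empirical (pi_c p i.1 (D i.2)))) => [i _|//|].
- by apply: subdist_empirical; rewrite card_file expn_gt0.
move=> f3 Pf3; apply: (subdist_chain_cond (A := fun m f => fronthaul p f D H m)
  (w := fun _ => fronthaul_weight)) => [i _|//|].
- by apply: subdist_uniform; rewrite powR_gt0.
move=> f4 Pf4.
(* The condition accumulated by the four peelings so far. *)
pose P4 f := xpredT f && [forall n, unrequested n ==> (f n == f1 n)] &&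
  [forall i, (i.1.1 \in U) ==> (signal_feature i f == signal_feature i f2)] &&
  [forall i, cached i ==> (cache_feature i f == cache_feature i f3)] &&
  [forall m, (m \notin S) ==> (fronthaul p f D H m == fronthaul p f4 D H m)].
rewrite (eq_bigl P4)//.
have P44 : P4 f4.
  apply/andP; split; first exact: Pf4.
  by apply/forallP => m; rewrite eqxx implybT.
have agree f f' : P4 f -> P4 f' ->
  [/\ forall n, unrequested n -> f n = f' n,
      forall i, i.1.1 \in U -> signal_feature i f = signal_feature i f',
      forall i, cached i -> cache_feature i f = cache_feature i f' &
      forall m, m \notin S -> fronthaul p f D H m = fronthaul p f' D H m].
  move=> /andP[/andP[/andP[/forallP a1 /forallP a2] /forallP a3] /forallP a4].
  move=> /andP[/andP[/andP[/forallP b1 /forallP b2] /forallP b3] /forallP b4].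
  split=> i Ji.
  - by rewrite (eqP (implyP (a1 i) Ji)) (eqP (implyP (b1 i) Ji)).
  - by rewrite (eqP (implyP (a2 i) Ji)) (eqP (implyP (b2 i) Ji)).
  - by rewrite (eqP (implyP (a3 i) Ji)) (eqP (implyP (b3 i) Ji)).
  - by rewrite (eqP (implyP (a4 i) Ji)) (eqP (implyP (b4 i) Ji)).
have qeq f f' k : P4 f -> P4 f' -> k \in U ->
    qsignal p H D f k = qsignal p H D f' k.
  move=> Pf Pf' kU; apply/funext => t; have [_ a2 _ _] := agree _ _ Pf Pf'.
  have h (c : bool) : quant (coord (k, t, (c, true)) f) = quant (coord (k, t, (c, true)) f').
    apply: quant_eq; last exact: (a2 (k, t, (c, false)) kU).
    by have := a2 (k, t, (c, true)) kU; rewrite /signal_feature /=; do 2 case: (_ < 0).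
  by rewrite /qsignal; have := h true; have := h false; rewrite /coord /= => -> ->.
(* On this class the rounded signals of the users in [U] are constant, so their decoding weights are
   fixed laws. *)
rewrite (eq_bigr (fun f => (\prod_(k | k \in U)
    decode_weight k (estimate p H D U S B f4 k) (f (D k))) *
    ((\prod_(k | (k \in V) && (k \notin U)) user_weight f k) * 1))); last first.
  move=> f Pf; rewrite (eq_bigr (fun k =>
    decode_weight k (estimate p H D U S B f4 k) (f (D k))))// => k kU.
  rewrite /user_weight (_ : estimate p H D U S B f k = estimate p H D U S B f4 k)//.
  by apply/funext => t; rewrite /estimate kU (qeq _ _ _ Pf P44 kU).
apply: (subdist_chain_cond (A := fun k f => f (D k))
  (w := fun k => decode_weight k (estimate p H D U S B f4 k))) => [k _|//|].
- exact: subdist_decode_weight.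
move=> f5 Pf5.
(* With the files of [U] also known, the codewords outside [S] are constant, hence so are the
   estimates of the remaining users. *)
rewrite (eq_bigr (fun f => (\prod_(k | (k \in V) && (k \notin U))
    decode_weight k (estimate p H D U S B f5 k) (f (D k))) * 1)); last first.
  move=> f /andP[Pf /forallP fU].
  have [a1 _ a3 a4] := agree _ _ Pf Pf5.
  have side_eq k' t : side p H D S f k' t = side p H D S f5 k' t.
    apply: eq_bigr => m mS; rewrite (@codeword_eq f f5)//; first exact: a4.
    by move=> u uU; exact: (eqP (implyP (fU u) uU)).
  rewrite (eq_bigr (fun k =>
    decode_weight k (estimate p H D U S B f5 k) (f (D k))))// => k _.
  rewrite /user_weight (_ : estimate p H D U S B f k = estimate p H D U S B f5 k)//.
  apply/funext => t; rewrite /estimate.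
  case: ifPn => kU; first by rewrite (qeq f f5).
  rewrite side_eq; congr (_ + _); apply: eq_bigr => u uU.
  by rewrite side_eq (qeq f f5).
apply: (subdist_chain_cond (A := fun k f => f (D k))
  (w := fun k => decode_weight k (estimate p H D U S B f5 k))) => [k _|//|].
- exact: subdist_decode_weight.
(* The fixed data now determine every file, requested or not. *)
move=> f6 Pf6; rewrite (big_pred1 f6)// => f /=.
apply/idP/eqP => [/andP[/andP[Pf /forallP fU] /forallP fV]|->]; last first.
  by rewrite Pf6 /=; apply/forallP => k; rewrite eqxx implybT.
have /andP[Pf6' /forallP f6U] := Pf6.
have [a1 _ _ _] := agree _ _ Pf Pf6'.
apply/ffunP => n; have [/a1 //|] := boolP (unrequested n).
rewrite negb_forall => /existsP[k]; rewrite negb_imply negbK => /andP[kV /eqP <-].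
have [kU|kU] := boolP (k \in U); last by apply/eqP/(implyP (fV k)); rewrite kV.
by rewrite (eqP (implyP (fU k) kU)) (eqP (implyP (f6U k) kU)).
Qed.

(** * Average cost in bits of each factor *)

Lemma log2_code_weight f :
  - log2 (code_weight f) =
  #|[pred n | unrequested n]|%:R * L%:R +
  (\sum_(i | i.1.1 \in U) - log2 (signal_weight i (signal_feature i f)) +
  (\sum_(i | cached i)
     - log2 (empirical (pi_c p i.1 (D i.2)) (cache_feature i f)) +
  (#|[pred m | m \notin S]|%:R * ((TF p)%:R * CF) +
  \sum_(k in V) - log2 (user_weight f k)))).
Proof.
have uw0 k : 0 < user_weight f k by exact: decode_weight_gt0.
have f0 m : 0 < fronthaul_weight (fronthaul p f D H m).
  by rewrite fronthaul_weightE invr_gt0 powR_gt0.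
rewrite /code_weight mulr1.
have h1 : 0 < \prod_(n | unrequested n) (2 ^+ L)^-1 :> R.
  by apply: prodr_gt0 => i _; exact: file_weight_gt0.
have h2 : 0 < \prod_(i | i.1.1 \in U) signal_weight i (signal_feature i f).
  by apply: prodr_gt0 => i _; exact: signal_weight_gt0.
have h3 : 0 < \prod_(i | cached i)
    empirical (pi_c p i.1 (D i.2)) (cache_feature i f) :> R.
  by apply: prodr_gt0 => i _; exact: empirical_gt0.
have h4 : 0 < \prod_(m | m \notin S) fronthaul_weight (fronthaul p f D H m).
  by apply: prodr_gt0 => i _.
have h5 (P : pred 'I_K) : 0 < \prod_(k | P k) user_weight f k.
  by apply: prodr_gt0 => i _.
rewrite log2M ?mulr_gt0// log2M ?mulr_gt0// log2M ?mulr_gt0//.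
rewrite log2M ?mulr_gt0// log2M ?mulr_gt0//.
rewrite !log2_prod//; try by move=> i _; first
  [exact: signal_weight_gt0|exact: empirical_gt0|exact: file_weight_gt0].
have -> : \sum_(k in V) - log2 (user_weight f k) =
    - \sum_(k in U) log2 (user_weight f k)
    - \sum_(k | (k \in V) && (k \notin U)) log2 (user_weight f k).
  rewrite (bigID (mem U))/= !sumrN; congr (- _ - _); apply: eq_bigl => k.
  by rewrite andb_idl//; exact: (fintype.subsetP UV).
have -> : \sum_(n | unrequested n) log2 (2 ^+ L)^-1 =
    - (#|[pred n | unrequested n]|%:R * L%:R) :> R.
  rewrite log2V ?exprn_gt0// log2X// log2_2 mulr1.
  by rewrite sumr_const -[_ *+ _]mulr_natl mulrN.
have -> : \sum_(m | m \notin S) log2 (fronthaul_weight (fronthaul p f D H m)) =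
    - (#|[pred m | m \notin S]|%:R * ((TF p)%:R * CF)).
  rewrite (eq_bigr (fun=> - ((TF p)%:R * CF))); last first.
    by move=> m _; rewrite fronthaul_weightE log2V ?powR_gt0// log2_powR2.
  by rewrite sumr_const -[_ *+ _]mulr_natl mulrN.
rewrite !sumrN; ring.
Qed.

Let avg (g : library N L -> R) : R := (\sum_f g f) / #|library N L|%:R.

Let lib_gt0 : 0 < #|library N L|%:R :> R.
Proof. by rewrite ltr0n card_ffun expn_gt0 card_file expn_gt0. Qed.

Let avg_cst c : avg (fun=> c) = c.
Proof. by rewrite /avg sumr_const -[_ *+ _]mulr_natl mulrAC mulfV ?gt_eqF// mul1r. Qed.

Let avgD g h : avg (fun f => g f + h f) = avg g + avg h.
Proof. by rewrite /avg big_split /= mulrDl. Qed.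

Let avg_sum (I : Type) (s : seq I) (P : pred I) (g : I -> library N L -> R) :
  avg (fun f => \sum_(i <- s | P i) g i f) = \sum_(i <- s | P i) avg (g i).
Proof. by rewrite /avg exchange_big /= big_distrl. Qed.

Let avg_le g h : (forall f, g f <= h f) -> avg g <= avg h.
Proof. by move=> gh; rewrite ler_wpM2r ?invr_ge0 ?(ltW lib_gt0)// ler_sum. Qed.

(** Two sign bits, twice the constant 3 of the heavy tail, and its quadratic term averaged by the
    power constraint, in which the power cancels. *)
Definition signal_overhead : R :=
  2 + (6 + 2 * (M%:R * channel_energy H * M%:R)) / ln 2.

(** The signs cost one bit each and the two integer parts half of [log2 pow] each, up to the
    quadratic terms. *)
Lemma signal_cost_at f k t :
  \sum_cb - log2 (signal_weight (k, t, cb) (signal_feature (k, t, cb) f)) <=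
  log2 pow + 2 + (6 + 2 / pow * Normc.normc (signal p H D f k t) ^+ 2) / ln 2.
Proof.
have pow_gt0 : 0 < pow by exact: lt_le_trans pow_ge1.
rewrite -(pair_bigA _ (fun c b => - log2 (signal_weight (k, t, (c, b))
  (signal_feature (k, t, (c, b)) f)))) /= !big_bool /=.
have hs c : - log2 (signal_weight (k, t, (c, true))
    (signal_feature (k, t, (c, true)) f)) = 1.
  rewrite /signal_weight /signal_feature /= ler_nat ltnS.
  by rewrite (_ : (_ <= 1)%N) ?log2V ?log2_2 ?opprK//; case: (_ < 0).
have hj c : - log2 (signal_weight (k, t, (c, false))
    (signal_feature (k, t, (c, false)) f)) <=
    log2 (Num.sqrt pow) + (3 + 2 * coord (k, t, (c, false)) f ^+ 2 / pow) / ln 2.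
  rewrite /signal_weight /signal_feature /=.
  apply: (le_trans (log2_heavy_tail _ sqrt_pow_ge1)).
  rewrite lerD2l ler_wpM2r ?invr_ge0 ?(ltW ln2_gt0)// lerD2l.
  rewrite sqr_sqrtr ?(ltW pow_gt0)// ler_wpM2r ?invr_ge0 ?(ltW pow_gt0)//.
  rewrite ler_wpM2l// -[leRHS]real_normK ?num_real// lerXn2r ?nnegrE//.
  by rewrite truncn_le.
rewrite !hs; apply: (le_trans (lerD (lerD (lexx _) (hj _)) (lerD (lexx _) (hj _)))).
have -> : log2 pow = log2 (Num.sqrt pow) + log2 (Num.sqrt pow).
  by rewrite -{1}(sqr_sqrtr (ltW pow_gt0)) log2X ?sqrtr_gt0//; ring.
rewrite sqr_normcE /coord /= le_eqVlt; apply/orP; left; apply/eqP.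
by field; rewrite !gt_eqF// ln2_gt0.
Qed.

Lemma sum_signal_index (F : 'I_K * 'I_(TE p) * (bool * bool) -> R) :
  \sum_(i | i.1.1 \in U) F i = \sum_(k in U) \sum_t \sum_cb F (k, t, cb).
Proof.
rewrite pair_big_dep /= pair_big_dep /=.
by apply: eq_big => [[[k t] cb]|[[k t] cb]] //=; rewrite !andbT.
Qed.

Lemma signal_cost :
  avg (fun f => \sum_(i | i.1.1 \in U)
    - log2 (signal_weight i (signal_feature i f))) <=
  #|U|%:R * (TE p)%:R * (log2 pow + signal_overhead).
Proof.
have pow_gt0 : 0 < pow by exact: lt_le_trans pow_ge1.
apply: (@le_trans _ _ (avg (fun f => \sum_(k in U) \sum_t (log2 pow + 2 +
    (6 + 2 / pow * Normc.normc (signal p H D f k t) ^+ 2) / ln 2)))).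
  apply: avg_le => f; rewrite sum_signal_index.
  by apply: ler_sum => k _; apply: ler_sum => t _; exact: signal_cost_at.
rewrite avg_sum (_ : #|U|%:R * _ * _ =
    \sum_(k in U) (TE p)%:R * (log2 pow + signal_overhead)); last first.
  by rewrite sumr_const -[RHS]mulr_natl mulrA.
apply: ler_sum => k _.
set c := log2 pow + 2 + 6 / ln 2.
have E f : \sum_t (log2 pow + 2 +
    (6 + 2 / pow * Normc.normc (signal p H D f k t) ^+ 2) / ln 2) =
    (TE p)%:R * c + 2 / pow / ln 2 * \sum_t Normc.normc (signal p H D f k t) ^+ 2.
  rewrite (eq_bigr (fun t => c + 2 / pow / ln 2 *
    Normc.normc (signal p H D f k t) ^+ 2)); last by move=> t _; rewrite /c; ring.
  by rewrite big_split /= sumr_const card_ord -[c *+ _]mulr_natl big_distrr.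
rewrite (_ : avg _ = avg (fun f => (TE p)%:R * c + 2 / pow / ln 2 *
    \sum_t Normc.normc (signal p H D f k t) ^+ 2)); last first.
  by congr avg; apply/funext.
rewrite avgD avg_cst /avg -big_distrr /= -mulrA.
have := average_signal_power H D k p_adm; set A := _ / _ => hA.
have ln2p : 0 < (ln 2)^-1 :> R by rewrite invr_gt0 ln2_gt0.
apply: (@le_trans _ _ ((TE p)%:R * c + 2 / pow / ln 2 *
    (M%:R * channel_energy H * (M%:R * ((TE p)%:R * pow))))).
  rewrite lerD2l ler_wpM2l// mulr_ge0 ?(ltW ln2p)// divr_ge0// ltW//.
rewrite /c /signal_overhead le_eqVlt; apply/orP; left; apply/eqP.
by field; rewrite !gt_eqF// ln2_gt0.
Qed.

Lemma cache_cost :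
  avg (fun f => \sum_(i | cached i)
    - log2 (empirical (pi_c p i.1 (D i.2)) (cache_feature i f))) <=
  #|[pred m | m \notin S]|%:R * (#|V|%:R - #|U|%:R) * (mu * L%:R).
Proof.
have [cache_le _ _ _] := p_adm.
rewrite avg_sum (eq_bigl (fun i => (i.1 \notin S) && ((i.2 \in V) && (i.2 \notin U))))//.
rewrite -(pair_big_dep (fun m => m \notin S) (fun _ k => (k \in V) && (k \notin U))
  (fun m k => avg (fun f => - log2 (empirical (pi_c p m (D k)) (cache_feature (m, k) f))))) /=.
have cV : #|V|%:R - #|U|%:R = #|[pred k | (k \in V) && (k \notin U)]|%:R :> R.
  apply/eqP; rewrite subr_eq -natrD eqr_nat addnC; apply/eqP.
  rewrite -(cardID (mem U) (mem V)); congr (_ + _)%N; apply: eq_card => k.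
    by rewrite !inE andb_idl//; exact: (fintype.subsetP UV).
  by rewrite !inE andbC.
have cE : \sum_(m | m \notin S) \sum_(k | (k \in V) && (k \notin U)) mu * L%:R =
    #|[pred m | m \notin S]|%:R * #|[pred k | (k \in V) && (k \notin U)]|%:R
    * (mu * L%:R).
  rewrite !sumr_const -[LHS]mulr_natl -mulrA; congr (_ * _).
  by rewrite mulr_natl.
rewrite cV -cE.
apply: ler_sum => m _; apply: ler_sum => k _.
apply: le_trans (cache_le m (D k)).
by rewrite entropy_empirical /avg (sum_ffun_coord (D k)
  (fun x => - log2 (empirical (pi_c p m (D k)) (pi_c p m (D k) x))))// card_file expn_gt0.
Qed.

Hypothesis rowsB : forall k m, k \in V -> m \in S ->
  H k m = \sum_(u in U) B k u * H u m.
Hypothesis z_indep : mutually_independent z.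
Hypothesis z_gaussian : forall i, std_complex_gaussian (z i).

Definition decoding_overhead : R :=
  log2 ((2 * expR (estimate_radius B ^+ 2)) ^+ 2).

Lemma decode_cost_avg k : k \in V ->
  avg (fun f => - log2 (user_weight f k)) <=
  2 + (TE p)%:R * decoding_overhead + 2 * user_error p z H D k * L%:R.
Proof.
move=> kV; have [_ _ _ mdec] := p_adm.
have r0 : 0 <= estimate_radius B.
  rewrite addr_ge0//; apply: sumr_ge0 => i _; apply: sumr_ge0 => u _.
  by rewrite mulr_ge0// normc_ge0.
have X_indep : mutually_independent (fun t => z (k, t)).
  by apply: (mutually_independent_reindex (f := pair k)) z_indep => ? ? [].
have h f := @decode_cost R d Omega Pr L (TE p) (fun y => pi_d p k y (D k) H)
  (fun t => z (k, t)) X_indep (fun t => z_gaussian (k, t)) (estimate_radius B) r0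
  (signal p H D f k) (estimate p H D U S B f k)
  (fun t => le_trans (Re_le_normc _) (estimate_close D rowsB f t kV))
  (fun t => le_trans (Im_le_normc _) (estimate_close D rowsB f t kV))
  (f (D k)) (mdec k (D k) H (f (D k))).
apply: (le_trans (avg_le h)).
rewrite avgD avg_cst lerD2l /avg -big_distrl -big_distrr /=.
by rewrite mulrAC -[2 * _ / _]mulrA.
Qed.

Hypothesis D_inj : injective D.

Lemma card_unrequested : #|[pred n | unrequested n]|%:R = N%:R - #|V|%:R :> R.
Proof.
apply/eqP; rewrite eq_sym subr_eq -natrD eqr_nat; apply/eqP.
rewrite -[N in LHS]card_ord -(cardC (mem (imset D (mem V)))) addnC.
congr (_ + _)%N; last exact: (card_imset (mem V) D_inj).
apply: eq_card => n; rewrite !inE; apply/idP/forallP => [nV k|h].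
  by apply/implyP => kV; apply: contra nV => /eqP <-; exact: imset_f.
by apply/imsetP => -[k kV nk]; have := implyP (h k) kV; rewrite nk eqxx.
Qed.

(** Gibbs' inequality gives [N L] on the left; the [N - #|V|] unrequested files cost exactly [L]
    bits each and cancel. *)
Lemma converse_bound :
  #|V|%:R * L%:R <=
  #|U|%:R * (TE p)%:R * (log2 pow + signal_overhead) +
  #|[pred m | m \notin S]|%:R * (#|V|%:R - #|U|%:R) * (mu * L%:R) +
  #|[pred m | m \notin S]|%:R * ((TF p)%:R * CF) +
  #|V|%:R * (2 + (TE p)%:R * decoding_overhead + 2 * error_prob p z H * L%:R).
Proof.
have card_lib : (0 < #|library N L|)%N by rewrite -(ltr0n R).
have := gibbs_uniform card_lib code_weight_gt0 sum_code_weight.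
have -> : log2 #|library N L|%:R = N%:R * L%:R :> R.
  rewrite card_ffun card_file card_ord -expnM natrX log2X// log2_2 mulr1.
  by rewrite natrM mulrC.
rewrite (eq_bigr _ (fun f _ => log2_code_weight f)) -[X in _ <= X]/(avg _).
rewrite !avgD !avg_cst card_unrequested.
have hV : avg (fun f => \sum_(k in V) - log2 (user_weight f k)) <=
    #|V|%:R * (2 + (TE p)%:R * decoding_overhead + 2 * error_prob p z H * L%:R).
  rewrite avg_sum mulr_natl -sumr_const; apply: ler_sum => k kV.
  apply: (le_trans (decode_cost_avg kV)).
  rewrite lerD2l ler_wpM2r// ler_wpM2l//.
  rewrite /error_prob; apply: (le_trans _ (le_bigmax _ _ D)).
  exact: (le_bigmax _ (fun k => user_error p z H D k) k).
have := signal_cost; have := cache_cost; move: hV; lra.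
Qed.

End Converse.

(** * From the converse to the linear program *)

Lemma card_superset (T : finType) (A : {set T}) (l : nat) :
  (#|A| <= l <= #|T|)%N -> exists2 B : {set T}, A \subset B & #|B| = l.
Proof.
move=> /andP[Al lT]; have [n ln] : exists n, l = (#|A| + n)%N.
  by exists (l - #|A|)%N; rewrite subnKC.
elim: n A ln {Al} => [|n IH] A ln.
  by exists A; rewrite ?ln ?addn0.
have [x xA] : exists x, x \notin A.
  apply/existsP; rewrite -negb_forall; apply/negP => /forallP AT.
  have : #|T| = #|A| by apply: eq_card => x; rewrite AT.
  by move=> E; move: lT; rewrite ln E addnS ltnNge leq_addr.
have [|B xAB Bl] := IH (x |: A)%SET; first by rewrite cardsU1 xA ln addnS.
by exists B => //; apply: fintype.subset_trans xAB; exact: finset.subsetUr.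
Qed.

(** The columns in [S] form a matrix of rank at most [l], so at most [l] of its rows span the
    others; this set is then padded to size [l]. *)
Lemma row_basis_set (F : fieldType) (m n l : nat) (A : 'M[F]_(m, n))
    (S : {set 'I_n}) : (#|S| <= l <= m)%N ->
  exists2 U : {set 'I_m}, #|U| = l & exists B : 'I_m -> 'I_m -> F,
    forall i j, j \in S -> A i j = \sum_(u in U) B i u * A u j.
Proof.
move=> /andP[Sl lm].
pose AS : 'M[F]_(m, #|S|) := colsub (fun j : 'I_#|S| => enum_val j) A.
have /submxP[X AX] : (AS <= rowsub (maxrankfun AS) AS)%MS.
  by rewrite eq_maxrowsub submx_refl.
set f := maxrankfun AS in X AX.
have [|U fU Ul] := @card_superset _ (imset f (mem [set: 'I_(\rank AS)]%SET)) l.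
  rewrite card_imset; last exact: maxrankfun_inj.
  by rewrite cardsT !card_ord (leq_trans (rank_leq_col _) Sl).
(* Padding rows, being outside the image of [f], get an empty sum and thus coefficient 0. *)
exists U => //; exists (fun i u => \sum_(k | f k == u) X i k) => i j jS.
have -> : A i j = AS i (enum_rank_in jS j) by rewrite mxE enum_rankK_in.
rewrite {1}AX mxE; under [RHS]eq_bigr do rewrite big_distrl /=.
rewrite (exchange_big_dep xpredT)//=; apply: eq_bigr => k _.
have fkU : f k \in U by apply: (fintype.subsetP fU); rewrite imset_f.
rewrite (big_pred1 (f k)) => [|u]; last first.
  by rewrite /= [u == _]eq_sym; have [<-|] := eqVneq (f k) u; rewrite ?fkU ?andbF.
by rewrite !mxE enum_rankK_in.
Qed.

Section LinearProgram.
Context {R : realType} (M K : nat) (mu r : R).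
Hypothesis r_ge0 : 0 <= r.

(* Raising both coordinates of a nearly feasible point makes it feasible; only
   the constraint [l = 0] uses [dF], and it is vacuous or violated outright when
   [M * r = 0]. *)
Lemma delta_LB_le (b : R) :
  (forall eta, 0 < eta -> exists x y,
    [/\ 0 <= x, 0 <= y, x + y <= b, 1 - eta <= y &
    forall l : nat, (l <= minn M K)%N ->
      K%:R - (M%:R - l%:R) * (K%:R - l%:R) * mu - eta <=
      l%:R * y + (M%:R - l%:R) * r * x]) ->
  (delta_LB M K mu r <= b%:E)%E.
Proof.
move=> approx; apply/lee_addgt0Pr => e e0.
(* Raising [dF] by [eta * q] repairs the constraint [l = 0] and raising [dE] by [eta] the others;
   [eta] is chosen so that the total increase is [e]. *)
pose q : R := if M%:R * r == 0 then 0 else (M%:R * r)^-1.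
have q0 : 0 <= q by rewrite /q; case: ifP => // _; rewrite invr_ge0 mulr_ge0.
have q1 : 0 < 1 + q by rewrite ltr_pwDl.
pose eta := e / (1 + q).
have eta0 : 0 < eta by rewrite divr_gt0.
have [x [y [x0 y0 xyb y1 hl]]] := approx _ eta0.
have etaq0 : 0 <= eta * q by rewrite mulr_ge0// ltW.
apply: ge_ereal_inf; exists (x + eta * q + (y + eta))%:E; last first.
  rewrite -EFinD lee_fin.
  have : eta * q + eta = e by rewrite /eta; field; exact: lt0r_neq0.
  lra.
exists (x + eta * q, y + eta) => //=; split => /=; [|by rewrite addr_ge0|lra].
move=> [|l] lMK; last first.
  have lM : l.+1%:R <= M%:R :> R by rewrite ler_nat (leq_trans lMK)// geq_minl.
  have h1 : eta <= l.+1%:R * eta by rewrite ler_peMl ?(ltW eta0)// ler1n.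
  have h2 : 0 <= (M%:R - l.+1%:R) * r * (eta * q).
    by rewrite mulr_ge0// mulr_ge0// subr_ge0.
  by have := hl _ lMK; lra.
have := hl 0%N lMK; rewrite !subr0 !mul0r !add0r mulrDr.
have [Mr0|Mr0] := eqVneq (M%:R * r) 0.
  (* Here the constraint does not involve the variables; it holds up to every slack, hence
     exactly. *)
  move=> _; rewrite Mr0 !mul0r addr0; apply/ler_addgt0Pr => g g0.
  have [x' [y' [_ _ _ _ /(_ 0%N lMK)]]] := approx _ g0.
  by rewrite !subr0 !mul0r !add0r Mr0 mul0r; lra.
rewrite /q (negPf Mr0) [eta * _]mulrC mulrA mulfV// mul1r; lra.
Qed.

End LinearProgram.

(** * Bounds uniform in the policy, the file length and the power *)

Section UniformConverse.
Context {R : realType} (M K N : nat) (mu r : R).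
Context (d : measure_display) (Omega : measurableType d)
  (Pr : probability Omega R) (z : 'I_K * nat -> {RV Pr >-> R[i]}).
Hypotheses (K_gt0 : (0 < K)%N) (K_le_N : (K <= N)%N).
Hypothesis z_indep : mutually_independent z.
Hypothesis z_gaussian : forall i, std_complex_gaussian (z i).
Variable H : channel R K M.

Let D : demand K N := [ffun k => widen_ord K_le_N k].

Let D_inj : injective D.
Proof. by move=> i j; rewrite !ffunE => /(congr1 val) /= /val_inj. Qed.

(** All users, with the first [l] ENs as [S]. The basis [U] and its coefficients come from the
    channel alone, so [c] can be chosen before the policy and the power. *)
Lemma cut_set_bound (l : nat) : (l <= minn M K)%N ->
  exists c : R, forall L (p : policy R M K N L) pow, 1 <= pow ->
    admissible p mu (r * log2 pow) pow ->
    K%:R * L%:R <= l%:R * ((TE p)%:R * log2 pow) +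
      (M%:R - l%:R) * r * ((TF p)%:R * log2 pow) +
      (M%:R - l%:R) * (K%:R - l%:R) * mu * L%:R +
      c * (TE p)%:R + K%:R * (2 + 2 * error_prob p z H * L%:R).
Proof.
rewrite leq_min => /andP[lM lK].
pose S : {set 'I_M} := finset (fun m : 'I_M => (m < l)%N).
have cS : #|S| = l.
  rewrite /S cardsE -sum1_card (eq_bigl (fun m : 'I_M => (m < l)%N))//.
  by rewrite -(big_ord_widen M (fun=> 1%N) lM) sum1_card card_ord.
have cS' : #|[pred m | m \notin S]|%:R = M%:R - l%:R :> R.
  apply/eqP; rewrite eq_sym subr_eq -natrD eqr_nat addnC; apply/eqP.
  by rewrite -{1}cS -[M in LHS]card_ord -(cardC (mem S)).
have [|U Ul [B hB]] := @row_basis_set _ _ _ l H S; first by rewrite cS leqnn.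
exists (l%:R * signal_overhead H + K%:R * decoding_overhead B).
move=> L p pow pow1 adm.
have := @converse_bound R M K N L d Omega Pr z p H D [set: 'I_K]%SET U S B
  mu (r * log2 pow) pow adm pow1 (finset.subsetT _) (fun k m _ mS => hB k m mS)
  z_indep z_gaussian D_inj.
rewrite cS' cardsT card_ord Ul; lra.
Qed.

(** With all ENs in [S] and [U = V] a single user, no cache or fronthaul term remains. *)
Lemma single_user_bound :
  exists c : R, forall L (p : policy R M K N L) pow, 1 <= pow ->
    admissible p mu (r * log2 pow) pow ->
    L%:R <= (TE p)%:R * log2 pow + c * (TE p)%:R +
      (2 + 2 * error_prob p z H * L%:R).
Proof.
pose k0 := Ordinal K_gt0; pose V : {set 'I_K} := [set k0]%SET.
pose B (k u : 'I_K) : R[i] := (k == u)%:R.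
exists (signal_overhead H + decoding_overhead B) => L p pow pow1 adm.
have rowsB k m : k \in V -> m \in [set: 'I_M]%SET ->
    H k m = \sum_(u in V) B k u * H u m.
  by rewrite inE => /eqP -> _; rewrite big_set1 /B eqxx mul1r.
have := @converse_bound R M K N L d Omega Pr z p H D V V [set: 'I_M]%SET B
  mu (r * log2 pow) pow adm pow1 (subxx _) rowsB z_indep z_gaussian D_inj.
rewrite cards1 subrr mulr0 !mul0r (_ : #|[pred m | _]| = 0%N); last first.
  by apply: eq_card0 => m; rewrite !inE.
rewrite !mul0r; lra.
Qed.

Lemma uniform_converse :
  exists2 c : R, 0 <= c & forall L (p : policy R M K N L) pow, 1 <= pow ->
    admissible p mu (r * log2 pow) pow ->
    (forall l : nat, (l <= minn M K)%N ->
      K%:R * L%:R <= l%:R * ((TE p)%:R * log2 pow) +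
        (M%:R - l%:R) * r * ((TF p)%:R * log2 pow) +
        (M%:R - l%:R) * (K%:R - l%:R) * mu * L%:R +
        c * (TE p)%:R + K%:R * (2 + 2 * error_prob p z H * L%:R)) /\
    L%:R <= (TE p)%:R * log2 pow + c * (TE p)%:R +
      (2 + 2 * error_prob p z H * L%:R).
Proof.
have [c0 hc0] := single_user_bound.
have /choice[C hC] : forall l : nat, exists c : R, (l <= minn M K)%N ->
    forall L (p : policy R M K N L) pow, 1 <= pow ->
    admissible p mu (r * log2 pow) pow ->
    K%:R * L%:R <= l%:R * ((TE p)%:R * log2 pow) +
      (M%:R - l%:R) * r * ((TF p)%:R * log2 pow) +
      (M%:R - l%:R) * (K%:R - l%:R) * mu * L%:R +
      c * (TE p)%:R + K%:R * (2 + 2 * error_prob p z H * L%:R).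
  move=> l; have [lMK|_] := boolP (l <= minn M K)%N; last by exists 0.
  by have [c hc] := cut_set_bound lMK; exists c.
pose s : R := \sum_(l < (minn M K).+1) `|C l|.
have s0 : 0 <= s by apply: sumr_ge0 => l _.
exists (`|c0| + s); first by rewrite addr_ge0.
move=> L p pow pow1 adm; split=> [l lMK|].
  have := hC l lMK L p pow pow1 adm.
  have : C l * (TE p)%:R <= (`|c0| + s) * (TE p)%:R.
    rewrite ler_wpM2r// (le_trans (ler_norm _))// /s.
    rewrite (bigD1 (Ordinal (lMK : (l < (minn M K).+1)%N)))//= addrCA lerDl.
    by rewrite addr_ge0// sumr_ge0.
  lra.
have := hc0 L p pow pow1 adm.
have : c0 * (TE p)%:R <= (`|c0| + s) * (TE p)%:R.
  by rewrite ler_wpM2r// (le_trans (ler_norm _))// lerDl.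
lra.
Qed.

End UniformConverse.

(** * Limits in the file length and the power *)

Lemma limn_esup_lt (R : realType) (u : nat -> \bar R) (a : \bar R) :
  (limn_esup u < a)%E -> \forall n \near \oo, (u n < a)%E.
Proof.
move=> /ereal_inf_ltP[_ [A nA <-] supA]; apply: filterS nA => n An.
by apply: le_lt_trans supA; apply: ereal_sup_ubound; exists n.
Qed.

Section Achievability.
Context (R : realType) (M K N : nat) (mu r : R)
  (dH : measure_display) (OmegaH : measurableType dH)
  (PrH : probability OmegaH R) (h : 'I_K * 'I_M -> {RV PrH >-> R[i]})
  (dZ : measure_display) (OmegaZ : measurableType dZ)
  (PrZ : probability OmegaZ R) (z : 'I_K * nat -> {RV PrZ >-> R[i]}).

(* One channel realization is good for a whole sequence of powers tending to
   infinity, so the overhead of the converse is a single constant. *)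
Lemma achievable_ndt_sequence (delta : \bar R) (b : R) :
  achievable_ndt N h z mu r delta -> (delta < b%:E)%E ->
  exists (H : channel R K M) (n0 : nat)
    (p : nat -> forall L, policy R M K N L),
    [/\ forall n L, admissible (p n L) mu (r * log2 (2 ^+ (n0 + n))) (2 ^+ (n0 + n)),
      forall n, (fun L => error_prob (p n L) z H) @ \oo --> 0 &
      forall n, \forall L \near \oo,
        (TF (p n L) + TE (p n L))%:R / L%:R * (n0 + n)%:R < b].
Proof.
move=> [Delta [[A1 [_ ach]] Dcvg]] db.
have [A2 [_ lt_b]] : \forall pow \near +oo, (Delta pow * (log2 pow)%:E < b%:E)%E.
  by apply: (Dcvg [set y | (y < b%:E)%E]); exact: open_ereal_lt'.
(* All powers [2 ^+ (n0 + n)] exceed both thresholds, and the successor makes their logarithms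
   positive. *)
pose n0 := (Num.truncn (`|A1| + `|A2|)).+1.
pose pow n : R := 2 ^+ (n0 + n).
have pow_gt n : `|A1| + `|A2| < pow n.
  have /andP[_ h1] := truncn_itv (addr_ge0 (normr_ge0 A1) (normr_ge0 A2)).
  apply: (lt_le_trans h1); rewrite /pow -natrX ler_nat.
  by apply: (leq_trans (leq_addr n n0)); exact/ltnW/ltn_expl.
have pow_gt1 n : A1 < pow n.
  by apply: le_lt_trans (pow_gt n); rewrite (le_trans (ler_norm _))// lerDl.
have pow_gt2 n : A2 < pow n.
  by apply: le_lt_trans (pow_gt n); rewrite (le_trans (ler_norm _))// lerDr.
have log2_pow n : log2 (pow n) = (n0 + n)%:R by rewrite log2X// log2_2 mulr1.
have /choice[p hp] := fun n => ach (pow n) (pow_gt1 n).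
have feas : {ae PrH, forall w n,
    (fun L => error_prob (p n L) z (channel_at h w)) @ \oo --> 0}.
  by apply: ae_foralln => n; have [_ + _] := hp n.
have [w hw] : exists w, forall n,
    (fun L => error_prob (p n L) z (channel_at h w)) @ \oo --> 0.
  (* An almost sure event is nonempty: otherwise the whole space would be a null set. *)
  apply: contrapT => /forallNP no_w; case: feas => A [mA A0 sA].
  have AT : A = setT by apply/seteqP; split => // w _; apply: sA; exact: no_w.
  by move: A0; rewrite AT probability_setT => /eqP; rewrite onee_eq0.
exists (channel_at h w), n0, p; split => // n.
  by have [+ _ _] := hp n; apply.
have [_ _ DE] := hp n; have := lt_b _ (pow_gt2 n); rewrite log2_pow DE.
have lp0 : 0 < (n0 + n)%:R :> R by rewrite ltr0n addSn.
rewrite -lte_pdivlMr// => /limn_esup_lt; apply: filterS => L.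
by rewrite -EFinM lte_fin ltr_pdivlMr.
Qed.

(** The normalized times [TF / L] and [TE / L], multiplied by [log2] of the power, are nearly
    feasible when first the power and then [L] is taken large. *)
Lemma achievable_ndt_ge (K_gt0 : (0 < K)%N) (K_le_N : (K <= N)%N) (r_ge0 : 0 <= r)
    (z_iid : iid z) (z_gaussian : forall i, std_complex_gaussian (z i))
    (delta : \bar R) (b : R) :
  achievable_ndt N h z mu r delta -> (delta < b%:E)%E ->
  (delta_LB M K mu r <= b%:E)%E.
Proof.
move=> ach db; have [H [n0 [p [adm err lt_b]]]] := achievable_ndt_sequence ach db.
have [c c0 conv] := @uniform_converse R M K N mu r dZ OmegaZ PrZ z K_gt0 K_le_N
  z_iid.1 z_gaussian H.
apply: delta_LB_le => // eta eta0.
(* The normalized edge time is at most the absolute value of [b], so at this power the overhead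
   [c * TE / L] is at most [eta / 2]. *)
pose n := (Num.truncn (2 * (c * `|b|) / eta)).+1.
have lp0 : 0 < (n0 + n)%:R :> R by rewrite ltr0n addnS.
set lp : R := (n0 + n)%:R in lp0.
have cb : c * `|b| / lp <= eta / 2.
  have x0 : 0 <= 2 * (c * `|b|) / eta by rewrite divr_ge0 ?(ltW eta0)// !mulr_ge0.
  have /andP[_ h1] := truncn_itv x0.
  have : 2 * (c * `|b|) / eta <= lp by rewrite (le_trans (ltW h1))// ler_nat leq_addl.
  by rewrite !ler_pdivrMr//; lra.
have K0 : 0 < K%:R :> R by rewrite ltr0n.
(* For large [L] the decoding term is at most [4 * e] per user, that is [eta / 2] for all [K]
   users. *)
pose e := eta / (8 * K%:R).
have e0 : 0 < e by rewrite divr_gt0// mulr_gt0.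
have [L [L0 eL errL ltL]] : exists L : nat, [/\ 0 < L%:R :> R, 2 <= e * 2 * L%:R,
    error_prob (p n L) z H <= e &
    (TF (p n L) + TE (p n L))%:R / L%:R * lp < b].
  have h1 : \forall L \near \oo, error_prob (p n L) z H <= e.
    by have /cvgr_le := err n; apply.
  near \oo => L.
  have L1 : e^-1 < L%:R by near: L; exact: nbhs_infty_gtr.
  have L0 : 0 < L%:R :> R by rewrite (lt_trans _ L1)// invr_gt0.
  exists L; split => //.
  - have : e * e^-1 <= e * L%:R by rewrite ler_wpM2l ?ltW.
    by rewrite mulfV ?gt_eqF//; lra.
  - by near: L.
  - by near: L; exact: lt_b.
have lpE : log2 (2 ^+ (n0 + n)) = lp :> R by rewrite log2X// log2_2 mulr1.
clearbody lp.
have lpn0 : lp != 0 by rewrite gt_eqF.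
have L0' : L%:R != 0 :> R by rewrite gt_eqF.
pose x := (TF (p n L))%:R / L%:R * lp; pose y := (TE (p n L))%:R / L%:R * lp.
have x0 : 0 <= x by rewrite mulr_ge0 ?divr_ge0// ltW.
have y0 : 0 <= y by rewrite mulr_ge0 ?divr_ge0// ltW.
have xy : x + y < b by move: ltL; rewrite natrD !mulrDl.
have yb : y <= `|b| by have := ler_norm b; lra.
have pow1 : 1 <= 2 ^+ (n0 + n) :> R by rewrite exprn_ege1// ler1n.
have [cut single] := conv L (p n L) _ pow1 (adm n L).
rewrite lpE in cut single.
have cTE : c * (TE (p n L))%:R / L%:R <= eta / 2.
  apply: le_trans cb.
  have -> : c * (TE (p n L))%:R / L%:R = c * y / lp.
    by rewrite /y; field; rewrite L0' lpn0.
  by rewrite ler_wpM2r ?invr_ge0 ?(ltW lp0)// ler_wpM2l.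
have errE : (2 + 2 * error_prob (p n L) z H * L%:R) / L%:R <= 4 * e.
  rewrite ler_pdivrMr//.
  have : 2 * error_prob (p n L) z H * L%:R <= 2 * e * L%:R.
    by rewrite ler_wpM2r ?(ltW L0)// ler_wpM2l.
  lra.
have Ke : K%:R * (4 * e) = eta / 2 by rewrite /e; field; rewrite gt_eqF.
have e4 : 4 * e <= eta / 2.
  by rewrite -Ke; apply: ler_peMl; [rewrite mulr_ge0// ltW|rewrite ler1n].
exists x, y; split => //; first exact: ltW.
- move: single; rewrite -(ler_pM2r (_ : 0 < (L%:R)^-1)) ?invr_gt0//.
  rewrite mulfV// !mulrDl => single.
  have : (TE (p n L))%:R * lp / L%:R = y by rewrite /y mulrAC.
  move: errE; rewrite mulrDl; lra.
- move=> l lMK; have := cut l lMK; rewrite -(ler_pM2r (_ : 0 < (L%:R)^-1)) ?invr_gt0//.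
  rewrite mulfK// => cl.
  have E : (l%:R * ((TE (p n L))%:R * lp) +
      (M%:R - l%:R) * r * ((TF (p n L))%:R * lp) +
      (M%:R - l%:R) * (K%:R - l%:R) * mu * L%:R + c * (TE (p n L))%:R +
      K%:R * (2 + 2 * error_prob (p n L) z H * L%:R)) / L%:R =
    l%:R * y + (M%:R - l%:R) * r * x + (M%:R - l%:R) * (K%:R - l%:R) * mu +
      c * (TE (p n L))%:R / L%:R +
      K%:R * ((2 + 2 * error_prob (p n L) z H * L%:R) / L%:R).
    by rewrite /x /y; field.
  have : K%:R * ((2 + 2 * error_prob (p n L) z H * L%:R) / L%:R) <= eta / 2.
    by rewrite -Ke ler_wpM2l.
  by move: cl; rewrite E; lra.
Unshelve. all: by end_near. Qed.

End Achievability.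

Theorem proposition1 (R : realType) (M K N : nat) (mu r : R)
  (dH : measure_display) (OmegaH : measurableType dH)
  (PrH : probability OmegaH R) (h : 'I_K * 'I_M -> {RV PrH >-> R[i]})
  (dZ : measure_display) (OmegaZ : measurableType dZ)
  (PrZ : probability OmegaZ R) (z : 'I_K * nat -> {RV PrZ >-> R[i]})
  (K_gt0 : (0 < K)%N) (K_le_N : (K <= N)%N)
  (mu01 : 0 <= mu <= 1) (r_ge0 : 0 <= r)
  (h_iid : iid h) (h_continuous : forall i, continuous_law (h i))
  (z_iid : iid z) (z_gaussian : forall i, std_complex_gaussian (z i)) :
  (delta_LB M K mu r <= min_ndt N h z mu r)%E.
Proof.
apply: le_ereal_inf_tmp => delta ach.
have ge b : (delta < b%:E)%E -> (delta_LB M K mu r <= b%:E)%E.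
  exact: achievable_ndt_ge ach.
case: delta ach ge => [a||] ach ge.
- apply/lee_addgt0Pr => e e0; rewrite -EFinD; apply: ge.
  by rewrite lte_fin ltrDl.
- exact: leey.
(* If [delta] is minus infinity, the program value lies below every real. *)
- by rewrite (eq_ninfty (fun a => ge a (ltNyr a))).
Qed.
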